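(* Let $d,K,J\ge 1$ be integers, let $\kappa_y,\kappa_\Psi,\kappa_h>0$, and let $\Sigma\in\mathbb R^{d\times d}$, $\Gamma\in\mathbb R^{K\times K}$ be symmetric positive definite. There exists a constant $C_{\mathsf B}=C_{\mathsf B}(\kappa_y,\kappa_\Psi,\kappa_h,\Sigma,\Gamma)$ such that, whenever $y_1^\dagger,\dots,y_J^\dagger\in\mathbb R^K$ satisfy $\max_{1\le j\le J}|y_j^\dagger|\le\kappa_y$, $\Psi\colon\mathbb R^d\to\mathbb R^d$ is Borel measurable with $|\Psi|\le\kappa_\Psi$ everywhere, and $h\colon\mathbb R^d\to\mathbb R^K$ is continuous with $|h|\le\kappa_h$ everywhere, one has for every probability measure $\mu$ on $\mathbb R^d$ and every $j\in\{0,\dots,J-1\}$ $$d_g(\mathsf B_j\mathsf G\mathsf Q\mathsf P\mu,\ \mathsf B_j\mathsf Q\mathsf P\mu)\le C_{\mathsf B}\,d_g(\mathsf G\mathsf Q\mathsf P\mu,\ \mathsf Q\mathsf P\mu).$$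
   Context: Notation: $|\cdot|$ is the Euclidean norm and, for $S$ symmetric positive definite, $|v|_S=|S^{-1/2}v|$. $\mathcal P^2(\mathbb R^n)$ is the set of Borel probability measures on $\mathbb R^n$ with finite second moment; $\mathcal M(\mu)$ and $\mathcal C(\mu)$ are the mean and covariance of $\mu$. Measures and their Lebesgue densities are denoted by the same symbol. With $g(v)=1+|v|^2$ on $\mathbb R^n$, $d_g(\mu_1,\mu_2)=\sup_{|f|\le g}\left|\int f\,d\mu_1-\int f\,d\mu_2\right|$ for $\mu_1,\mu_2\in\mathcal P^2(\mathbb R^n)$, the supremum being over measurable $f$ with $|f|\le g$ pointwise. Operators: - $\mathsf P\mu(u)=\frac{1}{\sqrt{(2\pi)^d\det\Sigma}}\int_{\mathbb R^d}\exp\left(-\tfrac12|u-\Psi(v)|_\Sigma^2\right)\mu(dv)$. - $\mathsf Q\mu(u,y)=\frac{1}{\sqrt{(2\pi)^K\det\Gamma}}\exp\left(-\tfrac12|y-h(u)|_\Gamma^2\right)\mu(u)$, a measure on $\mathbb R^d\times\mathbb R^K$. - For $\pi$ on $\mathbb R^d\times\mathbb R^K$ with continuous Lebesgue density, $\mathsf B_j\pi(u)=\pi(u,y_{j+1}^\dagger)\big/\int_{\mathbb R^d}\pi(U,y_{j+1}^\dagger)\,dU$. - $\mathsf G\pi=\mathcal N(\mathcal M(\pi),\mathcal C(\pi))$ for $\pi$ with finite second moments. *)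

(* Defs.v *)
From HB Require Import structures.
From mathcomp Require Import all_boot all_order all_algebra.
From mathcomp Require Import all_classical all_reals all_analysis.
From mathcomp Require Import measurable_realfun.

Set Implicit Arguments.
Unset Strict Implicit.
Unset Printing Implicit Defensive.

Import Order.TTheory GRing.Theory Num.Theory.
Import numFieldNormedType.Exports.

Local Open Scope classical_set_scope.
Local Open Scope ring_scope.

(** [R^n] is encoded as ['cV[R]_n] and [R^d * R^K] as ['cV[R]_(d + K)], the pair
    (u, y) being [col_mx u y]. The library has no sigma-algebra on matrices. *)

HB.instance Definition _ (R : realType) m n :=
  @isMeasurable.Build (sigma_display (@open 'M[R]_(m, n))) 'M[R]_(m, n)
    <<s @open 'M[R]_(m, n) >> (@sigma_algebra0 _ setT _) (@sigma_algebraC _ _)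
    (@sigma_algebra_bigcup _ setT _).

Lemma open_measurable_mx (R : realType) m n (U : set 'M[R]_(m, n)) :
  open U -> measurable U.
Proof. exact: sub_gen_smallest. Qed.

Lemma measurable_fun_mx d (T : measurableType d) (R : realType) m n
    (f : T -> 'M[R]_(m, n)) :
  (forall i j, measurable_fun [set: T] (fun x => f x i j)) ->
  measurable_fun [set: T] f.
Proof.
move=> mf.
apply: (@measurability _ _ _ _ _ _ (@open 'M[R]_(m, n))) => // _ [U oU <-].
rewrite setTI.
pose box (q : 'M[rat]_(m, n) * nat) : set 'M[R]_(m, n) :=
  [set v | forall i j, `|v i j - ratr (q.1 i j)| < q.2.+1%:R^-1].
have Ubox : U = \bigcup_(q in [set q | box q `<=` U]) box q.
  apply/seteqP; split=> [v Uv|v [q /= qU qv]]; last exact: qU.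
  have /nbhs_ballP[e /= e0 eU] : nbhs v U by exact: open_nbhs_nbhs.
  pose k := Num.truncn (2 / e).
  have k0 : (0 : R) < k.+1%:R^-1 by rewrite invr_gt0.
  have ke : k.+1%:R^-1 + k.+1%:R^-1 < e.
    rewrite -mulr2n -[_ *+ 2]mulr_natl ltr_pdivrMr ?ltr0n//.
    by rewrite mulrC -ltr_pdivrMr// truncnS_gt.
  have qP i j : exists q : rat, `|v i j - ratr q| < k.+1%:R^-1.
    have : v i j < v i j + k.+1%:R^-1 by rewrite ltrDl.
    move=> /rat_in_itvoo[q]; rewrite in_itv/= => /andP[q1 q2].
    exists q; rewrite distrC ger0_norm; first by rewrite ltrBlDl.
    by rewrite subr_ge0 ltW.
  exists (\matrix_(i, j) projT1 (cid (qP i j)), k) => /=; last first.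
    by move=> i j /=; rewrite mxE; case: cid.
  move=> w wq; apply: eU; split => // i j.
  rewrite /ball /= (le_lt_trans _ ke)//.
  have := wq i j; rewrite /= mxE; case: cid => q /= vq qw.
  by rewrite (le_trans (ler_distD (ratr q) _ _))// lerD// 1?distrC ltW// distrC.
rewrite Ubox preimage_bigcup bigcup_mkcond.
apply: countable_bigcupT_measurable => // q; case: ifP => _ //.
rewrite [X in measurable X](_ : _ = \bigcap_(i in [set: 'I_m])
  \bigcap_(j in [set: 'I_n])
    ((fun x => f x i j) @^-1` (ball (ratr (q.1 i j) : R) q.2.+1%:R^-1))); last first.
  apply/seteqP; split => [x fx i _ j _ | x fx i j].
    by rewrite /ball /= distrC; exact: fx.
  by rewrite distrC; exact: fx.
apply: fin_bigcap_measurable => // i _.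
apply: fin_bigcap_measurable => // j _.
rewrite -[X in measurable X]setTI; apply: mf => //.
exact: measurable_ball.
Qed.

Lemma measurable_coord_mx (R : realType) m n i j :
  measurable_fun [set: 'M[R]_(m, n)] (fun v => v i j).
Proof.
apply: (measurability _ (RGenOpens.measurableE R)).
move=> _ [_ [a [b ->] <-]]; rewrite setTI; apply: open_measurable_mx.
have /continuousP cij := @coord_continuous R m n i j.
exact/cij/interval_open.
Qed.

Definition cons_cV (R : realType) n (p : R * 'cV[R]_n) : 'cV[R]_n.+1 :=
  col_mx (const_mx p.1 : 'cV_1) p.2.

Lemma cons_cV0 (R : realType) n (p : R * 'cV[R]_n) : cons_cV p 0 0 = p.1.
Proof.
by rewrite mxE; case: splitP => // k _; rewrite mxE.
Qed.

Lemma cons_cVS (R : realType) n (p : R * 'cV[R]_n) i :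
  cons_cV p (lift 0 i) 0 = p.2 i 0.
Proof.
rewrite mxE; case: splitP => [k|k [ik]]; first by rewrite ord1.
by congr (p.2 _ _); apply/val_inj.
Qed.

Lemma measurable_cons_cV (R : realType) n :
  measurable_fun setT (@cons_cV R n).
Proof.
apply: measurable_fun_mx => i j; rewrite ord1.
have [->|[k ->]] : i = 0 \/ exists k, i = lift 0 k.
  by case: (unliftP 0 i) => [k ->|->]; [right; exists k|left].
  under eq_fun do rewrite cons_cV0; exact: measurable_fst.
under eq_fun do rewrite cons_cVS.
apply: (measurableT_comp (measurable_coord_mx k 0)); exact: measurable_snd.
Qed.

(** Iterated product of the one-dimensional Lebesgue measure, transported to
    column vectors; see [lebesgue_cV_box] for its value on boxes. *)
Fixpoint lebesgue_cV (R : realType) n : set 'cV[R]_n -> \bar R :=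
  match n with
  | 0 => \d_(0 : 'cV[R]_0)
  | n.+1 => pushforward (@lebesgue_measure R \x @lebesgue_cV R n)%E (@cons_cV R n)
  end.

Section lebesgue_cV_step.
Context (R : realType) (n : nat).
Variable mu : {sigma_finite_measure set 'cV[R]_n -> \bar R}.

Let nu := pushforward (@lebesgue_measure R \x mu)%E (@cons_cV R n).

Let mcons : measurable_fun setT (@cons_cV R n).
Proof. exact: measurable_cons_cV. Qed.

Let nu0 : nu set0 = 0%E. Proof. exact: measure0. Qed.

Let nu_ge0 A : (0 <= nu A)%E. Proof. exact: measure_ge0. Qed.

Let nu_sigma_additive : semi_sigma_additive nu.
Proof. exact: measure_semi_sigma_additive. Qed.

HB.instance Definition _ := isMeasure.Build _ _ _ nu nu0 nu_ge0 nu_sigma_additive.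

Let nu_sigma_finite : sigma_finite setT nu.
Proof.
pose f := @cons_cV R n.
pose g (v : 'cV[R]_n.+1) : R * 'cV[R]_n := (v 0 0, \col_i v (lift 0 i) 0).
have fg : cancel f g.
  move=> p; rewrite /g cons_cV0; case: p => r v; congr (_, _).
  by apply/matrixP => i j; rewrite mxE cons_cVS ord1.
have mg : measurable_fun setT g.
  apply/measurable_fun_pairP; split; first exact: measurable_coord_mx.
  apply: measurable_fun_mx => i j /=.
  under eq_fun do rewrite mxE.
  exact: measurable_coord_mx.
have /sigma_finiteP[F [TF ndF Foo]] := sigma_finiteT (@lebesgue_measure R).
have /sigma_finiteP[G [TG ndG Goo]] := sigma_finiteT mu.
exists (fun k => g @^-1` (F k `*` G k)).
  rewrite -preimage_bigcup (_ : \bigcup_k _ = setT) ?preimage_setT//.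
  apply/seteqP; split => // -[x y] _.
  have [a _ Fx] : (\bigcup_k F k) x by rewrite -TF.
  have [b _ Gy] : (\bigcup_k G k) y by rewrite -TG.
  exists (maxn a b) => //; split => /=.
  - by move: x Fx; exact/subsetPset/ndF/leq_maxl.
  - by move: y Gy; exact/subsetPset/ndG/leq_maxr.
move=> k; have [mF Fk] := Foo k; have [mG Gk] := Goo k; split.
  by rewrite -[X in measurable X]setTI; apply: mg => //; exact: measurableX.
rewrite /nu /pushforward (_ : _ @^-1` _ = F k `*` G k); last first.
  by rewrite -comp_preimage (_ : g \o _ = id) ?preimage_id//; exact/funext.
by rewrite product_measure1E// lte_mul_pinfty// ge0_fin_numE.
Qed.

HB.instance Definition _ := Measure_isSigmaFinite.Build _ _ _ nu nu_sigma_finite.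

Lemma lebesgue_cV_step : exists m : {sigma_finite_measure set 'cV[R]_n.+1 -> \bar R},
  nu = m.
Proof. by exists nu. Qed.

End lebesgue_cV_step.

Section lebesgue_cV_measure.
Context (R : realType) (n : nat).

Let lebesgue_cV_ex : exists m : {sigma_finite_measure set 'cV[R]_n -> \bar R},
  @lebesgue_cV R n = m.
Proof.
elim: n => [|k [m IH]]; first by exists (\d_(0 : 'cV[R]_0)).
by rewrite /= IH; exact: lebesgue_cV_step.
Qed.

Let leb0 : @lebesgue_cV R n set0 = 0%E.
Proof. by have [m ->] := lebesgue_cV_ex; exact: measure0. Qed.

Let leb_ge0 A : (0 <= @lebesgue_cV R n A)%E.
Proof. by have [m ->] := lebesgue_cV_ex; exact: measure_ge0. Qed.

Let leb_sigma_additive : semi_sigma_additive (@lebesgue_cV R n).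
Proof. by have [m ->] := lebesgue_cV_ex; exact: measure_semi_sigma_additive. Qed.

HB.instance Definition _ := isMeasure.Build _ _ _ (@lebesgue_cV R n)
  leb0 leb_ge0 leb_sigma_additive.

Let leb_sigma_finite : sigma_finite setT (@lebesgue_cV R n).
Proof. by have [m ->] := lebesgue_cV_ex; exact: sigma_finiteT. Qed.

HB.instance Definition _ := Measure_isSigmaFinite.Build _ _ _ (@lebesgue_cV R n)
  leb_sigma_finite.

End lebesgue_cV_measure.

Lemma lebesgue_cV_box (R : realType) n (A : 'I_n -> set R) :
    (forall i, measurable (A i)) ->
  lebesgue_cV [set v : 'cV[R]_n | forall i, A i (v i 0)] =
  (\prod_i lebesgue_measure (A i))%E.
Proof.
elim: n A => [|n IH] A mA.
  rewrite big_ord0 /= diracE mem_set// => -[].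
  by [].
rewrite big_ord_recl -IH; last by move=> i; exact: mA.
rewrite -product_measure1E; [|exact: mA|]; last first.
  rewrite (_ : [set _ | _] = \bigcap_(i in [set: 'I_n])
      ((fun v : 'cV[R]_n => v i 0) @^-1` A (lift 0 i))); last first.
    by apply/seteqP; split => [v vA i _|v vA i]; exact: vA.
  apply: fin_bigcap_measurable => // i _.
  by rewrite -[X in measurable X]setTI; exact: measurable_coord_mx.
rewrite /= /pushforward; congr (product_measure1 _ _ _).
apply/seteqP; split => [p pA|p [p1 p2] i] /=.
  split => [|i /=]; first by have := pA 0; rewrite cons_cV0.
  by have := pA (lift 0 i); rewrite cons_cVS.
by case: (unliftP 0 i) => [k|] ->; rewrite ?cons_cVS ?cons_cV0//; exact: p2.
Qed.

Section linear_algebra.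
Context (R : realType) (n : nat).
Implicit Types (S T : 'M[R]_n) (v : 'cV[R]_n).

(** The library norm on ['cV[R]_n] is the sup norm, hence: *)
Definition enorm v : R := Num.sqrt (\sum_i v i 0 ^+ 2).

Definition posdefmx S : Prop :=
  S^T = S /\ forall v, v != 0 -> 0 < (v^T *m S *m v) 0 0.

Definition possemidefmx S : Prop :=
  S^T = S /\ forall v, 0 <= (v^T *m S *m v) 0 0.

(** The unique positive semidefinite square root of a positive semidefinite
    [S]; [0] is only a default value. *)
Definition sqrtmx S : 'M[R]_n :=
  xget 0 [set T | possemidefmx T /\ T *m T = S].

(** |v|_S = |S^(-1/2) v| *)
Definition wnorm S v : R := enorm (invmx (sqrtmx S) *m v).

End linear_algebra.

(** Measures below are set functions [set T -> \bar R], as in the library's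
    [normal_prob] or [product_measure1]; [fine] turns the integrals of
    integrable functions into reals. *)
Section measures.
Context (R : realType) (n : nat).
Implicit Types (mu nu : set 'cV[R]_n -> \bar R) (p : 'cV[R]_n -> R).

Definition measure_of_density p : set 'cV[R]_n -> \bar R :=
  fun A => (\int[@lebesgue_cV R n]_(x in A) (p x)%:E)%E.

Definition mean mu : 'cV[R]_n := \col_i fine (\int[mu]_x (x i 0)%:E)%E.

Definition cov mu : 'M[R]_n := \matrix_(i, j)
  fine (\int[mu]_x ((x i 0 - mean mu i 0) * (x j 0 - mean mu j 0))%:E)%E.

Definition gauss_pdf (m : 'cV[R]_n) (S : 'M[R]_n) (x : 'cV[R]_n) : R :=
  (Num.sqrt ((2 * pi) ^+ n * \det S))^-1 *
  expR (- (2^-1 * wnorm S (x - m) ^+ 2)).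

(** N(m, S) for positive semidefinite [S]. When [S] is singular there is no
    density and N(m, S) is the law of m + S^(1/2) Z with Z standard normal. *)
Definition gaussian (m : 'cV[R]_n) (S : 'M[R]_n) : set 'cV[R]_n -> \bar R :=
  if S \in unitmx then measure_of_density (gauss_pdf m S)
  else pushforward (measure_of_density (gauss_pdf 0 1%:M))
         (fun z => m + sqrtmx S *m z).

Definition is_continuous_density nu p : Prop :=
  [/\ continuous p, forall x, 0 <= p x &
      forall A, measurable A -> nu A = measure_of_density p A].

(** A continuous Lebesgue density is unique when it exists. *)
Definition continuous_density nu : 'cV[R]_n -> R :=
  xget (cst 0) [set p | is_continuous_density nu p].

Definition dg mu1 mu2 : \bar R :=
  ereal_sup [set `| \int[mu1]_x (f x)%:E - \int[mu2]_x (f x)%:E |%E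
    | f in [set f : 'cV[R]_n -> R | measurable_fun [set: 'cV[R]_n] f /\
                                    forall x, `|f x| <= 1 + enorm x ^+ 2]].

End measures.

Section operators.
Context (R : realType) (d K : nat).

Definition opP (Psi : 'cV[R]_d -> 'cV[R]_d) (Sigma : 'M[R]_d)
    (mu : set 'cV[R]_d -> \bar R) : set 'cV[R]_d -> \bar R :=
  measure_of_density (fun u =>
    (Num.sqrt ((2 * pi) ^+ d * \det Sigma))^-1 *
    fine (\int[mu]_v (expR (- (2^-1 * wnorm Sigma (u - Psi v) ^+ 2)))%:E)%E).

(** [mu] need not have a density: the measure with "density"
    [gauss_pdf (h u) Gamma y] with respect to mu(du) dy. *)
Definition opQ (h : 'cV[R]_d -> 'cV[R]_K) (Gamma : 'M[R]_K)
    (mu : set 'cV[R]_d -> \bar R) : set 'cV[R]_(d + K) -> \bar R :=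
  fun A => (\int[mu]_u
    \int[@lebesgue_cV R K]_(y in [set y | A (col_mx u y)])
      (gauss_pdf (h u) Gamma y)%:E)%E.

Definition opB (ydag : nat -> 'cV[R]_K) (j : nat)
    (nu : set 'cV[R]_(d + K) -> \bar R) : set 'cV[R]_d -> \bar R :=
  let p := continuous_density nu in
  measure_of_density (fun u =>
    p (col_mx u (ydag j.+1)) /
    fine (\int[@lebesgue_cV R d]_U (p (col_mx U (ydag j.+1)))%:E)%E).

Definition opG n (nu : set 'cV[R]_n -> \bar R) : set 'cV[R]_n -> \bar R :=
  gaussian (mean nu) (cov nu).

End operators.

(* Main.v *)
Require Import Defs.
From HB Require Import structures.
From mathcomp Require Import all_boot all_order all_algebra.
From mathcomp Require Import perm complex.
From mathcomp Require Import all_classical all_reals all_analysis.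
From mathcomp Require Import measurable_realfun.
From mathcomp Require Import ring lra.

(** Let pi = Q P mu and rho = G pi, with densities p and g on R^d x R^K. The
    theorem bounds a distance between conditional laws, taken at the single
    observation y, by a distance between joint laws, which only sees averages
    over y. It rests on three facts.

    First, d_g is a weighted L^1 distance between densities ([dg_densityE]): the
    supremum is attained at f = (1 + |x|^2) sgn (p - g). Hence the claim compares
    the integral of (1 + |u|^2) |g(u, y) / Z_g - p(u, y) / Z_p| over u with the
    integral of (1 + |x|^2) |g(x) - p(x)| over R^d x R^K, where Z_g and Z_p are
    the masses of the slices g(., y) and p(., y).

    Second, on each fibre {u} x R^K both densities are exponentials of quadratic
    polynomials, and for two such functions the difference at one point is
    bounded by a constant times the integral of the difference over the fibre
    ([fibre_sup_le]). The reason is one-dimensional: on a line, the logarithm Q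
    of the ratio of the two functions is a quadratic polynomial, so
    Q(0) = 3 Q(1) - 3 Q(2) + Q(3), and Q cannot be small at 1, 2 and 3 if it is
    large at 0 ([expR_quadratic_diff_le]). The constant depends only on an upper
    bound for the second-order coefficients. Uniformity in the linear ones is
    essential: the conditional mean of rho given u is affine in u, thus
    unbounded. Integrating over u gives
      int (1 + |u|^2) |g - p|(u, y) du <= C int (1 + |x|^2) |g - p|(x) dx
    ([fibre_integral_le]).

    Third, normalizing the slices costs a bounded factor
    ([normalization_weighted_L1_le]), because
      g / Z_g - p / Z_p = (g - p) / Z_g + (Z_p - Z_g) p / (Z_g Z_p),
    where |Z_p - Z_g| is itself at most the integral of |g - p|. What is left is
    to bound Z_p and Z_g from below, and the second moment of p(., y) from above.

    All constants come from Gaussian bounds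
      c exp(- b |x|^2) <= p(x) <= A exp(- a |x|^2)
    in which A, a, b, c depend on the data only ([joint_density_le],
    [joint_density_ge]). The upper bound controls the mean and the covariance of
    pi; the lower bound shows that the covariance is at least a multiple of the
    identity ([cov_coercive]). This keeps rho nondegenerate, bounds the
    second-order coefficients of log g, and yields a Gaussian lower bound for g
    ([opG_density_ge]), hence for Z_g. *)

Set Implicit Arguments.
Unset Strict Implicit.
Unset Printing Implicit Defensive.

Import Order.TTheory GRing.Theory Num.Theory.
Import numFieldNormedType.Exports.

Local Open Scope classical_set_scope.
Local Open Scope ring_scope.

(** * Square roots of positive definite matrices *)

Lemma interpolating_poly (F : fieldType) (s : seq F) (f : F -> F) :
  exists q : {poly F}, {in s, forall x, q.[x] = f x}.
Proof.
elim: s => [|x s [q qf]]; first by exists 0.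
have [xs|xs] := boolP (x \in s).
  by exists q => y; rewrite inE => /predU1P[->|]; exact: qf.
pose w := \prod_(y <- s) ('X - y%:P).
have w0 : w.[x] != 0.
  by rewrite -[_ == 0]/(root w x) root_prod_XsubC.
exists (q + ((f x - q.[x]) / w.[x]) *: w) => y.
rewrite inE hornerD hornerZ => /predU1P[->|ys]; first by rewrite divfK// subrKC.
have -> : w.[y] = 0 by apply/eqP; rewrite -[_ == 0]/(root w y) root_prod_XsubC.
by rewrite mulr0 addr0 qf.
Qed.

Lemma trmx_horner_mx (F : fieldType) n (A : 'M[F]_n.+1) (p : {poly F}) :
  A^T = A -> (horner_mx A p)^T = horner_mx A p.
Proof.
move=> As; elim/poly_ind: p => [|p c ih]; first by rewrite rmorph0 trmx0.
rewrite rmorphD rmorphM /= horner_mx_X horner_mx_C linearD /= tr_scalar_mx.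
rewrite trmx_mul ih As; congr (_ + _).
exact: comm_mx_horner.
Qed.

Section sqrtmx.
Context (R : realType).
Local Notation C := (complex.complex R).
Local Notation toC := (@complex.real_complex_def R (Phant R)).

Lemma dotmxE n (v : 'cV[R]_n) : (v^T *m v) 0 0 = \sum_i v i 0 ^+ 2.
Proof. by rewrite mxE; apply: eq_bigr => i _; rewrite mxE -expr2. Qed.

Lemma dotmx_gt0 n (v : 'cV[R]_n) : v != 0 -> 0 < (v^T *m v) 0 0.
Proof.
move=> v0; rewrite dotmxE lt_def sumr_ge0 ?andbT => [|i _]; last exact: sqr_ge0.
apply: contra v0; rewrite psumr_eq0 => [|i _]; last exact: sqr_ge0.
move=> /allP v0; apply/eqP/matrixP => i j; rewrite ord1 mxE.
by apply/eqP; rewrite -sqrf_eq0; apply: v0; rewrite mem_index_enum.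
Qed.

(** Over R[i] the matrix S is Hermitian, hence unitarily diagonalizable with real
    eigenvalues. Each of these is an eigenvalue of the real matrix S too, so it has
    a real eigenvector, on which positivity of S can be tested. *)
Lemma spectral_posdefmx n (S : 'M[R]_n) : posdefmx S ->
  exists2 P : 'M[C]_n, P \in unitmx & exists2 s : 'rV[R]_n,
    (forall i, 0 < s 0 i) &
    map_mx toC S = invmx P *m diag_mx (map_mx toC s) *m P.
Proof.
move=> [Ssym Spos]; set SC := map_mx toC S.
have SCreal : SC \is a realmx.
  by apply/mxOverP => i j; rewrite mxE; apply/complex.complex_realP; exists (S i j).
have SCsym : SC \is symmetricmx.
  by apply/is_hermitianmxP; rewrite expr0 scale1r map_mx_id// map_trmx Ssym.
have SCherm := realsym_hermsym SCsym SCreal.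
have /orthomx_spectralP SCE := hermitian_normalmx SCherm.
have spreal := hermitian_spectral_diag_real SCherm.
set P := spectralmx SC in SCE; set sp := spectral_diag SC in SCE spreal.
have Pu : P \in unitmx by exact: spectral_unit.
pose s := map_mx (@complex.Re R) sp.
have sE : map_mx toC s = sp.
  apply/matrixP => i j; rewrite !mxE complex.RRe_real//.
  exact: (mxOverP spreal).
exists P => //; exists s; last by rewrite sE.
move=> i.
have : eigenvalue S (s 0 i).
  rewrite -(eigenvalue_map toC); apply/eigenvalueP; exists (row i P).
    rewrite -/SC -row_mul SCE !mulmxA mulmxV// mul1mx row_mul row_diag_mx.
    by rewrite -scalemxAl -rowE -{1}sE mxE.
  apply/eqP => /(congr1 (fun r => r *m invmx P)).
  rewrite -row_mul mulmxV// mul0mx => /rowP/(_ i); rewrite !mxE eqxx.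
  by move/eqP; rewrite oner_eq0.
move=> /eigenvalueP[v vS v0].
have vT0 : v^T != 0 by rewrite trmx_eq0.
have := Spos _ vT0; rewrite trmxK vS -scalemxAl mxE.
by rewrite pmulr_lgt0// -{1}[v]trmxK; exact: dotmx_gt0.
Qed.

(** The diagonalization lives over R[i], but a polynomial q(S) with real
    coefficients is real and symmetric. The polynomial q interpolates the fourth
    root on the spectrum, rather than the square root, because the square of a
    symmetric matrix W is positive semidefinite: v^T W^2 v = |W v|^2. *)
Lemma posdefmx_sqrt n (S : 'M[R]_n) : posdefmx S ->
  exists T : 'M[R]_n, possemidefmx T /\ T *m T = S.
Proof.
case: n S => [|n] S Spd.
  exists S; split; last by rewrite [RHS]flatmx0 flatmx0.
  by split=> [|v]; [case: Spd | rewrite mxE big_ord0].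
have [P Pu [s s0 SE]] := spectral_posdefmx Spd.
have [q qs] := interpolating_poly [seq s 0 i | i : 'I_n.+1]
  (fun x => Num.sqrt (Num.sqrt x)).
have {}qs i : q.[s 0 i] ^+ 4 = s 0 i.
  rewrite qs ?map_f ?mem_enum// (exprM _ 2 2) !sqr_sqrtr ?sqrtr_ge0//.
  exact: ltW.
pose W := horner_mx S q.
have W4 : W ^+ 4 = S.
  rewrite /W -rmorphXn /=.
  apply: (@map_mx_inj _ _ toC); rewrite map_horner_mx SE.
  set qC := map_poly _ _.
  have -> : horner_mx (invmx P *m diag_mx (map_mx toC s) *m P) qC =
      invmx P *m horner_mx (diag_mx (map_mx toC s)) qC *m P.
    exact: horner_mx_uconjC.
  rewrite horner_mx_diag; congr (_ *m diag_mx _ *m _).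
  apply/rowP => i; rewrite !mxE /qC.
  by rewrite horner_map/= !hornerE qs.
have WT : W^T = W by apply: trmx_horner_mx; case: Spd.
exists (W *m W); split; last by rewrite -[RHS]W4 (exprM W 2 2).
split=> [|v]; first by rewrite trmx_mul WT.
have -> : v^T *m (W *m W) *m v = (W *m v)^T *m (W *m v).
  by rewrite trmx_mul WT !mulmxA.
by rewrite dotmxE sumr_ge0// => i _; exact: sqr_ge0.
Qed.
End sqrtmx.

(** * Euclidean and weighted norms *)

Section enorm_theory.
Context (R : realType).

Lemma enorm_ge0 n (v : 'cV[R]_n) : 0 <= enorm v.
Proof. exact: sqrtr_ge0. Qed.

Lemma enorm2E n (v : 'cV[R]_n) : enorm v ^+ 2 = \sum_i v i 0 ^+ 2.
Proof. by rewrite sqr_sqrtr// sumr_ge0// => i _; exact: sqr_ge0. Qed.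

Lemma enorm2_dotmx n (v : 'cV[R]_n) : enorm v ^+ 2 = (v^T *m v) 0 0.
Proof. by rewrite enorm2E dotmxE. Qed.

Lemma sumr_CauchySchwarz (I : finType) (a b : I -> R) :
  (\sum_i a i * b i) ^+ 2 <= (\sum_i a i ^+ 2) * (\sum_i b i ^+ 2).
Proof.
rewrite -subr_ge0 expr2 !mulr_suml.
under [X in _ <= X - _]eq_bigr do rewrite mulr_sumr.
under [X in _ <= _ - X]eq_bigr do rewrite mulr_sumr.
have -> : \sum_i \sum_j a i ^+ 2 * b j ^+ 2 =
    \sum_i \sum_j (a i ^+ 2 * b j ^+ 2 + a j ^+ 2 * b i ^+ 2) / 2.
  under [RHS]eq_bigr do rewrite -mulr_suml big_split /= mulrDl.
  rewrite big_split /= [X in _ = _ + X](_ : _ =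
    \sum_i (\sum_j a i ^+ 2 * b j ^+ 2) / 2); last first.
    by rewrite -!mulr_suml exchange_big.
  by rewrite -big_split; apply: eq_bigr => i _ /=; rewrite -splitr.
rewrite -sumrB; apply: sumr_ge0 => i _; rewrite -sumrB; apply: sumr_ge0 => j _.
have -> : (a i ^+ 2 * b j ^+ 2 + a j ^+ 2 * b i ^+ 2) / 2 - a i * b i * (a j * b j)
  = (a i * b j - a j * b i) ^+ 2 / 2 by field.
by rewrite divr_ge0// sqr_ge0.
Qed.

Lemma enorm2_mulmx_le m n (M : 'M[R]_(m, n)) (v : 'cV[R]_n) :
  enorm (M *m v) ^+ 2 <= (\sum_i \sum_j M i j ^+ 2) * enorm v ^+ 2.
Proof.
rewrite !enorm2E mulr_suml; apply: ler_sum => i _.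
by rewrite mxE; exact: sumr_CauchySchwarz.
Qed.

Lemma dotmx_le n (u v : 'cV[R]_n) :
  (u^T *m v) 0 0 ^+ 2 <= enorm u ^+ 2 * enorm v ^+ 2.
Proof.
rewrite !enorm2E mxE; under eq_bigr do rewrite mxE.
exact: sumr_CauchySchwarz.
Qed.

Lemma enorm2_add_le n (u v : 'cV[R]_n) :
  enorm (u + v) ^+ 2 <= 2 * enorm u ^+ 2 + 2 * enorm v ^+ 2.
Proof.
rewrite !enorm2E !mulr_sumr -big_split; apply: ler_sum => i _ /=.
rewrite mxE -subr_ge0.
have -> : 2 * u i 0 ^+ 2 + 2 * v i 0 ^+ 2 - (u i 0 + v i 0) ^+ 2 =
  (u i 0 - v i 0) ^+ 2 by ring.
exact: sqr_ge0.
Qed.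

Lemma enormN n (v : 'cV[R]_n) : enorm (- v) = enorm v.
Proof.
by congr Num.sqrt; apply: eq_bigr => i _; rewrite mxE sqrrN.
Qed.

Lemma enorm2_col_mx m n (u : 'cV[R]_m) (v : 'cV[R]_n) :
  enorm (col_mx u v) ^+ 2 = enorm u ^+ 2 + enorm v ^+ 2.
Proof.
rewrite !enorm2E big_split_ord; congr (_ + _); apply: eq_bigr => i _.
  by rewrite col_mxEu.
by rewrite col_mxEd.
Qed.

Lemma coord_le_enorm2 n (v : 'cV[R]_n) i : v i 0 ^+ 2 <= enorm v ^+ 2.
Proof.
rewrite enorm2E (bigD1 i)//= lerDl sumr_ge0// => j _; exact: sqr_ge0.
Qed.

Lemma enorm2_le_unit n (z : 'cV[R]_n) : (forall i, `|z i 0| <= 1) -> enorm z ^+ 2 <= n%:R.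
Proof.
move=> z1; rewrite enorm2E -[n in n%:R]card_ord -sum1_card natr_sum.
by apply: ler_sum => i _; rewrite -real_normK ?num_real// expr_le1.
Qed.

Lemma det_norm_le n (M : 'M[R]_n) (b : R) : (forall i j, `|M i j| <= b) ->
  `|\det M| <= (n`!)%:R * b ^+ n.
Proof.
move=> Mb; rewrite /determinant (le_trans (ler_norm_sum _ _ _))//.
have -> : (n`!)%:R * b ^+ n = \sum_(s : 'S_n) b ^+ n.
  by rewrite sumr_const card_Sn mulr_natl.
apply: ler_sum => s _; rewrite normrM normrX normrN1 expr1n mul1r normr_prod.
rewrite -[n in b ^+ n]card_ord -prodr_const; apply: ler_prod => i _.
by rewrite normr_ge0 Mb.
Qed.

End enorm_theory.

Section wnorm_theory.
Context (R : realType) (n : nat).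
Implicit Types (S : 'M[R]_n) (v : 'cV[R]_n).

Lemma sqrtmxP S : posdefmx S ->
  possemidefmx (sqrtmx S) /\ sqrtmx S *m sqrtmx S = S.
Proof.
by move=> /posdefmx_sqrt ex; exact: (@xgetPex _ 0 [set T | possemidefmx T /\ _] ex).
Qed.

Lemma posdefmx_unit S : posdefmx S -> S \in unitmx.
Proof.
move=> [Ssym Spos]; rewrite -row_free_unit -kermx_eq0; apply/eqP/row_matrixP => i.
rewrite row0; apply/eqP/negP => /negP k0.
have := Spos (row i (kermx S))^T; rewrite trmx_eq0 => /(_ k0).
by rewrite trmxK -row_mul mulmx_ker row0 mul0mx mxE ltxx.
Qed.

Lemma sqrtmx_unit S : posdefmx S -> sqrtmx S \in unitmx.
Proof.
move=> Spd; have [_ TT] := sqrtmxP Spd.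
by have := posdefmx_unit Spd; rewrite -{1}TT unitmx_mul => /andP[].
Qed.

Lemma posdefmx_det_gt0 S : posdefmx S -> 0 < \det S.
Proof.
move=> Spd; have [_ <-] := sqrtmxP Spd.
rewrite det_mulmx -expr2 exprn_even_gt0//=.
by have := sqrtmx_unit Spd; rewrite unitmxE unitfE.
Qed.

Lemma wnormE S v : posdefmx S -> wnorm S v ^+ 2 = (v^T *m invmx S *m v) 0 0.
Proof.
move=> Spd; have [[Tsym _] TT] := sqrtmxP Spd.
rewrite /wnorm enorm2_dotmx -[in RHS]TT.
have Tu := sqrtmx_unit Spd.
have -> : invmx (sqrtmx S *m sqrtmx S) = invmx (sqrtmx S) *m invmx (sqrtmx S).
  have TTu : sqrtmx S *m sqrtmx S \in unitmx by rewrite TT posdefmx_unit.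
  by apply: (can_inj (mulKmx TTu)); rewrite mulmxV// mulmxA mulmxK// mulmxV.
by rewrite trmx_mul trmx_inv Tsym !mulmxA.
Qed.

Lemma wnorm_line S x z : exists b : R, forall t : R,
  wnorm S (x + t *: z) ^+ 2 = wnorm S x ^+ 2 + t * b + t ^+ 2 * wnorm S z ^+ 2.
Proof.
rewrite /wnorm; set L := invmx _.
exists (\sum_i 2 * (L *m x) i 0 * (L *m z) i 0) => t.
rewrite mulmxDr -scalemxAr !enorm2E !mulr_sumr -!big_split; apply: eq_bigr => i _ /=.
by move: (L *m x) (L *m z) => p q; rewrite !mxE; ring.
Qed.

(** With T the square root of S, v = T (T^-1 v), and |T w|^2 is at most the sum of
    the squared entries of T times |w|^2. *)
Lemma wnorm_coercive S : posdefmx S ->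
  exists2 a : R, 0 < a & forall v, a * enorm v ^+ 2 <= wnorm S v ^+ 2.
Proof.
move=> Spd; pose T := sqrtmx S.
pose F := 1 + \sum_i \sum_j T i j ^+ 2.
have F0 : 0 < F.
  by rewrite ltr_pwDl// sumr_ge0// => i _; apply: sumr_ge0 => j _; exact: sqr_ge0.
exists F^-1 => [|v]; first by rewrite invr_gt0.
rewrite mulrC ler_pdivrMr// mulrC -{1}[v](mulKVmx (sqrtmx_unit Spd)).
rewrite (le_trans (enorm2_mulmx_le _ _))// ler_wpM2r ?sqr_ge0//.
by rewrite lerDr.
Qed.

Lemma wnorm_bounded S : exists2 b : R, 0 < b &
  forall v, wnorm S v ^+ 2 <= b * enorm v ^+ 2.
Proof.
exists (1 + \sum_i \sum_j (invmx (sqrtmx S)) i j ^+ 2).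
  by rewrite ltr_pwDl// sumr_ge0// => i _; apply: sumr_ge0 => j _; exact: sqr_ge0.
move=> v; rewrite (le_trans (enorm2_mulmx_le _ _))// ler_wpM2r ?sqr_ge0//.
by rewrite lerDr.
Qed.

Lemma posdefmx_of_coercive S (l : R) : 0 < l -> S^T = S ->
  (forall v, l * enorm v ^+ 2 <= (v^T *m S *m v) 0 0) -> posdefmx S.
Proof.
move=> l0 Ssym Sl; split => // v v0; rewrite (lt_le_trans _ (Sl v))// mulr_gt0//.
by rewrite enorm2_dotmx dotmx_gt0.
Qed.

(** Put w = S^-1 v and q = v^T S^-1 v = w^T S w. By Cauchy-Schwarz and coercivity,
    q^2 = (v^T w)^2 <= |v|^2 |w|^2 <= |v|^2 q / l. *)
Lemma wnorm_le_coercive S (l : R) v : 0 < l -> S^T = S ->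
  (forall v, l * enorm v ^+ 2 <= (v^T *m S *m v) 0 0) ->
  wnorm S v ^+ 2 <= l^-1 * enorm v ^+ 2.
Proof.
move=> l0 Ssym Sl; have Spd := posdefmx_of_coercive l0 Ssym Sl.
rewrite wnormE//; set w := invmx S *m v.
have vE : v = S *m w by rewrite mulKVmx// posdefmx_unit.
rewrite -mulmxA -/w; set q := (v^T *m w) 0 0.
have ql : l * enorm w ^+ 2 <= q.
  have vT : v^T = w^T *m S by rewrite [in LHS]vE trmx_mul Ssym.
  by rewrite /q vT; exact: Sl.
have q0 : 0 <= q by rewrite (le_trans _ ql)// mulr_ge0 ?sqr_ge0// ltW.
have qq : q ^+ 2 <= enorm v ^+ 2 * (l^-1 * q).
  rewrite (le_trans (dotmx_le v w))// ler_wpM2l ?sqr_ge0//.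
  by rewrite mulrC ler_pdivlMr// mulrC.
have [->|qn0] := eqVneq q 0; first by rewrite mulr_ge0 ?sqr_ge0// invr_ge0 ltW.
have qp : 0 < q by rewrite lt_def qn0.
by rewrite -(ler_pM2r qp) -expr2 (le_trans qq)// mulrA [enorm v ^+ 2 * _]mulrC.
Qed.

End wnorm_theory.

(** * Integration against a measure given by a density *)

Section density.
Local Open Scope ereal_scope.
Context d (T : measurableType d) (R : realType).
Import HBNNSimple.

(** An integral only evaluates its set function on level sets of simple functions.
    Therefore a set function known on measurable sets, such as [opQ], can be
    replaced by an actual measure. *)
Lemma eq_integral_setfun (m1 m2 : set T -> \bar R) (f : T -> \bar R) :
  (forall A, measurable A -> m1 A = m2 A) -> \int[m1]_x f x = \int[m2]_x f x.
Proof.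
move=> m12; rewrite /integral.
by congr (ereal_sup _ - ereal_sup _); apply/seteqP; split => _ [h hf <-] /=;
  exists h => //; apply: eq_fsbigr => r _; rewrite m12.
Qed.

Variable mu : {measure set T -> \bar R}.
Variables (p : T -> R) (nu : set T -> \bar R).
Hypothesis mp : measurable_fun setT p.
Hypothesis p0 : forall x, (0 <= p x)%R.
Hypothesis nuE : forall A, measurable A -> nu A = \int[mu]_(x in A) (p x)%:E.

Let dens (A : set T) := \int[mu]_(x in A) (p x)%:E.
Let dens0 : dens set0 = 0. Proof. by rewrite /dens integral_set0. Qed.
Let dens_ge0 A : 0 <= dens A.
Proof. by apply: integral_ge0 => x _; rewrite lee_fin. Qed.
Let dens_sigma_additive : semi_sigma_additive dens.
Proof.
apply: semi_sigma_additive_nng_induced; first exact/measurable_EFinP.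
by move=> x; rewrite lee_fin.
Qed.

Let dens_mixin := isMeasure.Build _ _ _ dens dens0 dens_ge0 dens_sigma_additive.
Let dens_measure : {measure set T -> \bar R} := HB.pack dens dens_mixin.

Lemma ge0_integral_density (f : T -> \bar R) : measurable_fun setT f ->
  (forall x, 0 <= f x) -> \int[nu]_x f x = \int[mu]_x (f x * (p x)%:E).
Proof.
move=> mf f0; rewrite (@eq_integral_setfun _ dens_measure)//.
pose h := nnsfun_approx measurableT mf.
have fE x : f x = limn (EFin \o h^~ x).
  by apply/esym/cvg_lim => //; exact: cvg_nnsfun_approx.
transitivity (limn (fun n => \int[dens_measure]_x (h n x)%:E)).
  rewrite -monotone_convergence//.
  - by apply: eq_integral => x _; exact: fE.
  - by move=> n; exact/measurable_EFinP.
  - by move=> n x _; rewrite lee_fin.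
  - by move=> x _ a b ab; rewrite lee_fin; exact/lefP/nd_nnsfun_approx.
transitivity (limn (fun n => \int[mu]_x ((h n x)%:E * (p x)%:E))); last first.
  rewrite -monotone_convergence//.
  - apply: eq_integral => x _; apply/cvg_lim => //.
    by apply: cvgeZr => //; exact: cvg_nnsfun_approx.
  - move=> n; apply: emeasurable_funM; exact/measurable_EFinP.
  - by move=> n x _; rewrite mule_ge0// lee_fin.
  - move=> x _ a b ab; rewrite lee_wpmul2r ?lee_fin//.
    exact/lefP/nd_nnsfun_approx.
congr (limn _); apply/funext => n.
under [RHS]eq_integral => x _.
  rewrite fimfunE -fsumEFin// ge0_mule_fsuml; last first.
    by move=> r; exact: nnfun_muleindic_ge0.
  over.
rewrite ge0_integral_fsum//; last 2 first.
- move=> r; apply: emeasurable_funM; last exact/measurable_EFinP.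
  exact/measurable_EFinP/measurableT_comp.
- by move=> r x _; rewrite mule_ge0 ?lee_fin// -lee_fin nnfun_muleindic_ge0.
under [LHS]eq_integral do rewrite fimfunE -fsumEFin//.
rewrite ge0_integral_fsum//; last 2 first.
- by move=> r; exact/measurable_EFinP/measurableT_comp.
- by move=> r x _; exact: nnfun_muleindic_ge0.
apply: eq_fsbigr => r _.
rewrite integralZl_indic_nnsfun// integral_indic//= setIT.
have [r0|r0] := ltP r 0%R.
  rewrite [h n @^-1` _](_ : _ = set0); last first.
    by apply/seteqP; split => // x /= hx; move: r0; rewrite -hx ltNge fun_ge0.
  rewrite [RHS]integral0_eq => [|x _]; last by rewrite indic0 mulr0 mul0e.
  by rewrite -[RHS](mule0 r%:E); congr (_ * _); exact: dens0.
under eq_integral do rewrite EFinM -muleA.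
rewrite ge0_integralZl//; last 2 first.
- apply: emeasurable_funM; last exact/measurable_EFinP.
  exact/measurable_EFinP/measurable_indic.
- by move=> x _; rewrite mule_ge0// lee_fin.
congr (_ * _); rewrite /= /dens integral_mkcond/=; apply: eq_integral => x _.
rewrite /patch indicE; case: ifPn => xh; first by rewrite mul1e.
by rewrite mul0e.
Qed.

Lemma integral_density (f : T -> R) : measurable_fun setT f ->
  \int[nu]_x (f x)%:E = \int[mu]_x (f x * p x)%:E.
Proof.
move=> mf.
have nu_dens g : \int[nu]_x g x = \int[dens_measure]_x g x.
  exact: eq_integral_setfun.
rewrite nu_dens [LHS]integralE [RHS]integralE -!nu_dens.
have mef : measurable_fun setT (EFin \o f) by exact/measurable_EFinP.
rewrite !ge0_integral_density//.
- congr (_ - _); apply: eq_integral => x _.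
  + rewrite !funeposE -!EFin_max -EFinM maxr_pMl ?p0//.
    by rewrite mul0r.
  + rewrite !funenegE -!EFinN -!EFin_max -EFinM maxr_pMl ?p0//.
    by rewrite mul0r mulNr.
- exact: measurable_funeneg.
- exact: measurable_funepos.
Qed.

End density.

(** * Tonelli and homotheties for the Lebesgue measure on column vectors *)

Section lebesgue_cV_theory.
Context (R : realType).
Local Notation leb n := (@lebesgue_cV R n).

Lemma measurable_fun_continuous_mx m n (f : 'M[R]_(m, n) -> R) :
  continuous f -> measurable_fun setT f.
Proof.
move=> cf; apply: (measurability _ (RGenOpens.measurableE R)).
move=> _ [_ [a [b ->] <-]]; rewrite setTI; apply: open_measurable_mx.
move/continuousP: cf; apply; exact: interval_open.
Qed.

Lemma measurable_col_mxl m n (u : 'cV[R]_m) :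
  measurable_fun setT (fun y : 'cV[R]_n => col_mx u y).
Proof.
apply: measurable_fun_mx => i j; rewrite ord1.
rewrite -(splitK i); case: (fintype.split i) => k /=.
  by under eq_fun do rewrite col_mxEu; exact: measurable_cst.
by under eq_fun do rewrite col_mxEd; exact: measurable_coord_mx.
Qed.

Lemma measurable_col_mxr m n (y : 'cV[R]_n) :
  measurable_fun setT (fun u : 'cV[R]_m => col_mx u y).
Proof.
apply: measurable_fun_mx => i j; rewrite ord1.
rewrite -(splitK i); case: (fintype.split i) => k /=.
  by under eq_fun do rewrite col_mxEu; exact: measurable_coord_mx.
by under eq_fun do rewrite col_mxEd; exact: measurable_cst.
Qed.

Lemma measurable_col_mx m n :
  measurable_fun setT (fun p : 'cV[R]_m * 'cV[R]_n => col_mx p.1 p.2).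
Proof.
apply: measurable_fun_mx => i j; rewrite ord1.
rewrite -(splitK i); case: (fintype.split i) => k /=.
  under eq_fun do rewrite col_mxEu.
  by apply: (measurableT_comp (measurable_coord_mx k 0)); exact: measurable_fst.
under eq_fun do rewrite col_mxEd.
by apply: (measurableT_comp (measurable_coord_mx k 0)); exact: measurable_snd.
Qed.

Lemma measurable_affine n (a : 'cV[R]_n) t :
  measurable_fun setT (fun x : 'cV[R]_n => a + t *: x).
Proof.
apply: measurable_fun_mx => i j; under eq_fun do rewrite !mxE.
by apply: measurable_funD => //; apply: measurable_funM => //; exact: measurable_coord_mx.
Qed.

Local Open Scope ereal_scope.

Lemma integral_cons_cV n (F : 'cV[R]_n.+1 -> \bar R) : measurable_fun setT F ->
  (forall x, 0 <= F x) ->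
  \int[leb n.+1]_x F x = \int[lebesgue_measure]_t \int[leb n]_v F (cons_cV (t, v)).
Proof.
move=> mF F0; transitivity (\int[pushforward (@lebesgue_measure R \x leb n) (@cons_cV R n)]_x F x).
  by [].
have mcons : measurable_fun [set: measurableTypeR R * 'cV[R]_n] (@cons_cV R n).
  exact: measurable_cons_cV.
rewrite (ge0_integral_pushforward mcons)//.
rewrite preimage_setT fubini_tonelli1//; first exact: measurableT_comp.
by move=> x; exact: F0.
Qed.

Lemma integral_cV0 (F : 'cV[R]_0 -> \bar R) : \int[leb 0]_x F x = F 0%R.
Proof.
have -> : F = cst (F 0%R) by apply/funext => x; rewrite [x]flatmx0.
by rewrite [LHS]integral_cst//= diracT mule1.
Qed.

Lemma measurable_integral_col_mx m n (F : 'cV[R]_(m + n) -> \bar R) :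
  measurable_fun setT F -> (forall x, 0 <= F x) ->
  measurable_fun setT (fun u => \int[leb n]_y F (col_mx u y)).
Proof.
move=> mF F0.
apply: (@measurable_fun_fubini_tonelli_F _ _ _ _ _ (leb n) (fun q => F (col_mx q.1 q.2))).
  by apply: measurableT_comp => //; exact: measurable_col_mx.
by move=> q; exact: F0.
Qed.

Lemma integral_col_mx m n (F : 'cV[R]_(m + n) -> \bar R) : measurable_fun setT F ->
  (forall x, 0 <= F x) ->
  \int[leb (m + n)]_x F x = \int[leb m]_u \int[leb n]_y F (col_mx u y).
Proof.
elim: m F => [|m IH] F mF F0.
  rewrite integral_cV0.
  apply: eq_integral => y _; congr F; apply/matrixP => i j; rewrite mxE.
  by case: splitP => // [[]|k ik]//; congr (y _ _); exact/val_inj.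
rewrite (integral_cons_cV mF F0) [RHS]integral_cons_cV//; last 2 first.
- exact: measurable_integral_col_mx.
- by move=> u; apply: integral_ge0.
apply: eq_integral => t _.
have mFt : measurable_fun setT (fun v : 'cV[R]_(m + n) => F (cons_cV (t, v))).
  apply: measurableT_comp => //; apply: (measurableT_comp (@measurable_cons_cV R _)).
  exact: measurable_pair1.
rewrite (IH _ mFt) => [|x]; last exact: F0.
apply: eq_integral => u _; apply: eq_integral => y _; congr F.
rewrite /cons_cV /= col_mxA.
by apply/matrixP => i j; rewrite castmxE; congr (col_mx _ _ _ _); exact/val_inj.
Qed.

Lemma lebesgue_measure_affine (a t : R) (A : set R) : (t != 0)%R -> measurable A ->
  lebesgue_measure A = `|t|%:E *
    lebesgue_measure ((fun x => a + t * x)%R @^-1` A).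
Proof.
move=> t0 mA; pose phi : measurableTypeR R -> measurableTypeR R :=
  (fun x => a + t * x)%R.
have mphi : measurable_fun setT phi.
  by apply: measurable_funD => //; exact: measurable_funM.
pose pf : {measure set (measurableTypeR R) -> \bar R} :=
  measure_function_pushforward__canonical__measure_function_Measure
    lebesgue_measure mphi.
pose nu : {measure set (measurableTypeR R) -> \bar R} :=
  mscale (NngNum (normr_ge0 t)) pf.
apply: (@lebesgue_measure_unique R nu) => //.
move=> _ [[p q]] _ <-.
rewrite -[RHS]/(`|t|%:E * lebesgue_measure (phi @^-1` `]p, q]))/=.
have [tp|tn|t00] := ltgtP t 0%R; last by rewrite t00 eqxx in t0.
- rewrite (_ : _ @^-1` _ = `[((q - a) / t)%R, ((p - a) / t)%R[%classic); last first.
    apply/seteqP; split=> x; rewrite /= !in_itv /=.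
      rewrite ler_ndivrMr// ltr_ndivlMr// => /andP[]; rewrite /phi; lra.
    rewrite ler_ndivrMr// ltr_ndivlMr// => /andP[]; rewrite /phi; lra.
  rewrite !lebesgue_measure_itv/= !lte_fin ltr_nM2r ?invr_lt0// ltrD2r.
  case: ifPn => _; last by rewrite mule0.
  rewrite -EFinB -EFinM ltr0_norm//; congr EFin; field.
  by rewrite lt_eqF.
- rewrite (_ : _ @^-1` _ = `]((p - a) / t)%R, ((q - a) / t)%R]%classic); last first.
    apply/seteqP; split=> x; rewrite /= !in_itv /=.
      rewrite ler_pdivlMr// ltr_pdivrMr// => /andP[]; rewrite /phi; lra.
    rewrite ler_pdivlMr// ltr_pdivrMr// => /andP[]; rewrite /phi; lra.
  rewrite !lebesgue_measure_itv/= !lte_fin ltr_pM2r ?invr_gt0// ltrD2r.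
  case: ifPn => _; last by rewrite mule0.
  rewrite -EFinB -EFinM gtr0_norm//; congr EFin; field.
  by rewrite gt_eqF.
Qed.

Lemma integral_affine (a t : R) (f : R -> \bar R) : (t != 0)%R ->
  measurable_fun setT f -> (forall x, 0 <= f x) ->
  \int[lebesgue_measure]_x f x =
  `|t|%:E * \int[lebesgue_measure]_x f (a + t * x)%R.
Proof.
move=> t0 mf f0; pose phi : measurableTypeR R -> measurableTypeR R :=
  (fun x => a + t * x)%R.
have mphi : measurable_fun setT phi.
  by apply: measurable_funD => //; exact: measurable_funM.
pose pf : {measure set (measurableTypeR R) -> \bar R} :=
  measure_function_pushforward__canonical__measure_function_Measure
    lebesgue_measure mphi.
rewrite -[RHS]/(`|t|%:E * \int[lebesgue_measure]_(x in phi @^-1` setT) (f \o phi) x).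
rewrite -(ge0_integral_pushforward mphi)//.
rewrite -(@ge0_integral_mscale _ _ _ pf _ measurableT
  (NngNum (normr_ge0 t)))//.
apply: eq_integral_setfun => A mA.
exact: lebesgue_measure_affine.
Qed.

(** A homothety acts on the coordinates separately, so the one-dimensional change
    of variables goes through the iterated integral. *)
Lemma integral_cV_affine n (a : 'cV[R]_n) (t : R) (F : 'cV[R]_n -> \bar R) :
  (t != 0)%R -> measurable_fun setT F -> (forall x, 0 <= F x) ->
  \int[leb n]_x F x = (`|t| ^+ n)%:E * \int[leb n]_x F (a + t *: x)%R.
Proof.
move=> t0; elim: n a F => [|n IH] a F mF F0.
  by rewrite !integral_cV0 mul1e; congr F; apply/matrixP => -[].
rewrite (integral_cons_cV mF F0).
have mFa : measurable_fun setT (fun x : 'cV[R]_n.+1 => F (a + t *: x)%R).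
  by apply: measurableT_comp => //; exact: measurable_affine.
rewrite (integral_cons_cV mFa); last by move=> x; exact: F0.
pose b : 'cV[R]_n := \col_i a (lift 0%R i) 0%R.
have ab (x : R * 'cV[R]_n) : (a + t *: cons_cV x)%R = cons_cV (a 0 0 + t * x.1, b + t *: x.2)%R.
  apply/matrixP => i j; rewrite ord1.
  case: (unliftP 0%R i) => [k ->|->].
    by rewrite mxE mxE !cons_cVS !mxE.
  by rewrite mxE mxE !cons_cV0.
under [in RHS]eq_integral do under eq_integral do rewrite ab.
pose G s := \int[leb n]_v F (cons_cV (s, v)).
have G0 s : 0 <= G s by apply: integral_ge0.
have mFc : measurable_fun setT (F \o @cons_cV R n).
  by apply: measurableT_comp => //; exact: measurable_cons_cV.
have mG : measurable_fun setT G.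
  apply: (@measurable_fun_fubini_tonelli_F _ _ _ _ _ (leb n) (F \o @cons_cV R n)) => //.
  by move=> p; exact: F0.
have mFs s : measurable_fun setT (fun v => F (cons_cV (s, v))).
  by apply: (measurableT_comp mFc); exact: measurable_pair1.
have GE s : G s = (`|t| ^+ n)%:E * \int[leb n]_v F (cons_cV (s, b + t *: v)%R).
  by apply: (IH b (fun v => F (cons_cV (s, v)))).
rewrite (integral_affine (a 0 0)%R t0 mG G0) exprSr mulrC EFinM -muleA; congr (_ * _).
transitivity (\int[lebesgue_measure]_x ((`|t| ^+ n)%:E *
    \int[leb n]_v F (cons_cV ((a 0 0 + t * x)%R, (b + t *: v)%R)))).
  by apply: eq_integral => x _; exact: GE.
have mH : measurable_fun [set: measurableTypeR R * 'cV[R]_n]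
    (fun p => F (cons_cV ((a 0 0 + t * p.1)%R, (b + t *: p.2)%R))).
  apply: (measurableT_comp mFc); apply/measurable_fun_pairP; split => /=.
    by apply: measurable_funD => //; exact: measurable_funM.
  apply: (measurableT_comp (measurable_affine b t)); exact: measurable_snd.
rewrite ge0_integralZl//.
  exact: (@measurable_fun_fubini_tonelli_F _ _ (measurableTypeR R) _ _ (leb n) _ mH
    (fun p => F0 _)).
by move=> x _; apply: integral_ge0 => v _; exact: F0.
Qed.

End lebesgue_cV_theory.

(** * Gaussian bounds *)

Section gauss_envelope.
Context (R : realType).
Local Notation leb n := (@lebesgue_cV R n).

Lemma measurable_enorm2 n : measurable_fun [set: 'cV[R]_n] (fun x => enorm x ^+ 2).
Proof.
under eq_fun do rewrite enorm2E.
by apply: measurable_sum => i; apply: measurable_funX; exact: measurable_coord_mx.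
Qed.

Lemma measurable_weight n : measurable_fun [set: 'cV[R]_n] (fun x => 1 + enorm x ^+ 2).
Proof. by apply: measurable_funD => //; exact: measurable_enorm2. Qed.

Lemma weight_ge1 n (x : 'cV[R]_n) : 1 <= 1 + enorm x ^+ 2.
Proof. by rewrite lerDl sqr_ge0. Qed.

Lemma weight_gt0 n (x : 'cV[R]_n) : 0 < 1 + enorm x ^+ 2.
Proof. by rewrite (lt_le_trans ltr01)// weight_ge1. Qed.

Definition gauss n (a : R) (x : 'cV[R]_n) := expR (- (a * enorm x ^+ 2)).

Lemma gauss_gt0 n a (x : 'cV[R]_n) : 0 < gauss a x.
Proof. exact: expR_gt0. Qed.

Lemma gauss_ge0 n a (x : 'cV[R]_n) : 0 <= gauss a x.
Proof. exact: expR_ge0. Qed.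

Lemma gauss_le1 n a (x : 'cV[R]_n) : 0 <= a -> gauss a x <= 1.
Proof. by move=> a0; rewrite -expR0 ler_expR oppr_le0 mulr_ge0 ?sqr_ge0. Qed.

Lemma measurable_gauss n a : measurable_fun setT (@gauss n a).
Proof.
apply: measurableT_comp => //; apply: measurableT_comp => //.
by apply: measurable_funM => //; exact: measurable_enorm2.
Qed.

Lemma gauss_col_mx m n a (u : 'cV[R]_m) (v : 'cV[R]_n) :
  gauss a (col_mx u v) = gauss a u * gauss a v.
Proof. by rewrite /gauss enorm2_col_mx mulrDr opprD expRD. Qed.

Lemma gauss_decr n a b (x : 'cV[R]_n) : a <= b -> gauss b x <= gauss a x.
Proof. by move=> ab; rewrite ler_expR lerN2 ler_wpM2r ?sqr_ge0. Qed.

Lemma integral_expR_sqr_lty (a : R) : 0 < a ->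
  (\int[lebesgue_measure]_t (expR (- (a * t ^+ 2)))%:E < +oo)%E.
Proof.
move=> a0; pose s : R := Num.sqrt (a *+ 2)^-1.
have s0 : s != 0 by rewrite gt_eqF// sqrtr_gt0 invr_gt0 pmulrn_lgt0.
have s2 : s ^+ 2 = (a *+ 2)^-1 by rewrite sqr_sqrtr// invr_ge0 pmulrn_lge0// ltW.
rewrite (eq_integral (fun t : measurableTypeR R =>
  ((normal_peak s)^-1)%:E * (normal_pdf 0 s t)%:E)%E).
  rewrite ge0_integralZl//.
  - by rewrite integral_normal_pdf mule1 ltry.
  - by apply/measurable_EFinP; exact: measurable_normal_pdf.
  - by move=> x _; rewrite lee_fin normal_pdf_ge0.
  - by rewrite lee_fin invr_ge0 normal_peak_ge0.
move=> t _; rewrite -EFinM normal_pdfE// mulKf ?gt_eqF ?normal_peak_gt0//.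
congr (expR _)%:E; rewrite /normal_fun s2 subr0.
by field; rewrite gt_eqF.
Qed.

Lemma integral_gauss_lty n (a : R) : 0 < a ->
  (\int[leb n]_x (gauss a x)%:E < +oo)%E.
Proof.
move=> a0; elim: n => [|n IH]; first by rewrite integral_cV0 ltry.
have mg : measurable_fun setT (EFin \o @gauss n.+1 a).
  by apply/measurable_EFinP; exact: measurable_gauss.
rewrite (integral_cons_cV mg) => [|x]; last by rewrite lee_fin gauss_ge0.
pose I := (\int[leb n]_x (gauss a x)%:E)%E.
have I0 : (0 <= I)%E by apply: integral_ge0 => x _; rewrite lee_fin gauss_ge0.
have Ifin : (I \is a fin_num)%E by rewrite ge0_fin_numE.
rewrite (eq_integral (fun t : measurableTypeR R => (expR (- (a * t ^+ 2)))%:E * I)%E).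
  rewrite ge0_integralZr//.
  - have J0 : (0 <= \int[lebesgue_measure]_t (expR (- (a * t ^+ 2)))%:E)%E.
      by apply: integral_ge0 => t _; rewrite lee_fin expR_ge0.
    apply: lte_mul_pinfty => //.
    by rewrite ge0_fin_numE//; exact: integral_expR_sqr_lty.
  - apply/measurable_EFinP/measurableT_comp => //; apply: measurableT_comp => //.
    by apply: measurable_funM => //; exact: measurable_funX.
move=> t _; rewrite -ge0_integralZl//.
- apply: eq_integral => v _; rewrite -EFinM -expRD; congr (expR _)%:E.
  rewrite !enorm2E big_ord_recl cons_cV0/= mulrDr opprD; congr (- _ - (_ * _)).
  by apply: eq_bigr => i _; rewrite cons_cVS.
- by apply/measurable_EFinP; exact: measurable_gauss.
- by move=> v _; rewrite lee_fin gauss_ge0.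
Qed.

(** Half of the exponent absorbs the weight, since 1 + a r / 2 <= exp (a r / 2). *)
Lemma weight_gauss_le n (a : R) (x : 'cV[R]_n) : 0 < a ->
  (1 + enorm x ^+ 2) * gauss a x <= (1 + 2 / a) * gauss (a / 2) x.
Proof.
move=> a0; have -> : gauss a x = gauss (a / 2) x * gauss (a / 2) x.
  by rewrite /gauss -expRD; congr expR; field.
rewrite mulrA ler_wpM2r ?gauss_ge0// -ler_pdivlMr ?gauss_gt0//.
rewrite /gauss -expRN opprK; set r := enorm x ^+ 2.
have r0 : 0 <= r by exact: sqr_ge0.
apply: (@le_trans _ _ ((1 + 2 / a) * (1 + a / 2 * r))).
  have -> : (1 + 2 / a) * (1 + a / 2 * r) = 1 + r + (2 / a + a / 2 * r).
    by field; rewrite gt_eqF.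
  have a0' := ltW a0.
  by rewrite lerDl addr_ge0 ?divr_ge0// mulr_ge0// divr_ge0.
by rewrite ler_wpM2l ?expR_ge1Dx// addr_ge0// divr_ge0// (ltW a0).
Qed.

Definition gauss_moment n (a : R) : R :=
  fine (\int[leb n]_x ((1 + enorm x ^+ 2) * gauss a x)%:E)%E.

Lemma integral_weight_gauss n (a : R) : 0 < a ->
  (\int[leb n]_x ((1 + enorm x ^+ 2) * gauss a x)%:E = (gauss_moment n a)%:E)%E.
Proof.
move=> a0; rewrite fineK// ge0_fin_numE; last first.
  by apply: integral_ge0 => x _; rewrite lee_fin mulr_ge0 ?gauss_ge0// ltW ?weight_gt0.
apply: (@le_lt_trans _ _ (\int[leb n]_x ((1 + 2 / a)%:E * (gauss (a / 2) x)%:E))%E).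
  apply: ge0_le_integral => //.
  - by move=> x _; rewrite lee_fin mulr_ge0 ?gauss_ge0// ltW ?weight_gt0.
  - apply/measurable_EFinP; apply: measurable_funM;
    [exact: measurable_weight|exact: measurable_gauss].
  - by apply: emeasurable_funM => //; apply/measurable_EFinP; exact: measurable_gauss.
  - by move=> x _; rewrite -EFinM lee_fin weight_gauss_le.
have c0 : 0 <= 1 + 2 / a by rewrite addr_ge0// divr_ge0// ltW.
rewrite ge0_integralZl//.
- rewrite lte_mul_pinfty// integral_gauss_lty// divr_gt0//.
- by apply/measurable_EFinP; exact: measurable_gauss.
- by move=> x _; rewrite lee_fin gauss_ge0.
Qed.

Lemma gauss_moment_ge0 n a : 0 <= gauss_moment n a.
Proof.
apply: fine_ge0; apply: integral_ge0 => x _.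
by rewrite lee_fin mulr_ge0 ?gauss_ge0// ltW ?weight_gt0.
Qed.

Lemma integrable_gauss_le n (f : 'cV[R]_n -> R) (A a : R) : 0 < a ->
  measurable_fun setT f ->
  (forall x, `|f x| <= A * ((1 + enorm x ^+ 2) * gauss a x)) ->
  (leb n).-integrable setT (EFin \o f).
Proof.
move=> a0 mf fA; apply/integrableP; split; first exact/measurable_EFinP.
have A0 : 0 <= A.
  have /(le_trans (normr_ge0 _)) := fA 0; rewrite pmulr_lge0//.
  by rewrite mulr_gt0 ?gauss_gt0 ?weight_gt0.
apply: (@le_lt_trans _ _ (\int[leb n]_x (A%:E * ((1 + enorm x ^+ 2) * gauss a x)%:E))%E).
  apply: ge0_le_integral => //.
  - by apply/measurableT_comp => //; exact/measurable_EFinP.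
  - apply: emeasurable_funM => //; apply/measurable_EFinP; apply: measurable_funM;
    [exact: measurable_weight|exact: measurable_gauss].
  - by move=> x _; rewrite -EFinM lee_fin fA.
rewrite ge0_integralZl//.
- by rewrite integral_weight_gauss// -EFinM ltry.
- apply/measurable_EFinP; apply: measurable_funM;
    [exact: measurable_weight|exact: measurable_gauss].
- by move=> x _; rewrite lee_fin mulr_ge0 ?gauss_ge0// ltW ?weight_gt0.
Qed.

End gauss_envelope.

(** * Boxes, and uniqueness of continuous densities *)

Section continuous_density_theory.
Context (R : realType) (n : nat).
Local Notation leb n := (@lebesgue_cV R n).

Lemma lebesgue_cV_ball (x : 'cV[R]_n) (r : R) : 0 < r ->
  leb n (ball x r) = ((r *+ 2) ^+ n)%:E.
Proof.
move=> r0.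
transitivity (leb n [set v | forall i, (ball (x i 0) r : set R) (v i 0)]).
  congr (leb n _); apply/seteqP; split => v; first by move=> [_ xv] i; exact: xv.
  by move=> xv; split=> // i j; rewrite ord1; exact: xv.
rewrite (@lebesgue_cV_box _ _ (fun i => ball (x i 0) r)) => [|i]; last exact: measurable_ball.
under eq_bigr do rewrite lebesgue_measure_ball ?ltW//.
by rewrite prodEFin prodr_const card_ord.
Qed.

Lemma measurable_ball_cV (x : 'cV[R]_n) (r : R) : measurable (ball x r).
Proof.
have [r0|r0] := ltP 0 r; last first.
  by rewrite (_ : ball x r = set0)//; apply/seteqP; split => // v [/(le_lt_trans r0)]; rewrite ltxx.
by apply: open_measurable_mx; exact: ball_open.
Qed.

Definition unit_box : set 'cV[R]_n := [set x | forall i, `|x i 0| < 1].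

Lemma unit_boxE : unit_box = ball 0 1.
Proof.
apply/seteqP; split => x.
  by move=> x1; split=> // i j; rewrite ord1 /ball/= mxE sub0r normrN.
by move=> [_ x1] i; have := x1 i 0; rewrite /ball/= mxE sub0r normrN.
Qed.

Lemma measurable_unit_box : measurable unit_box.
Proof. by rewrite unit_boxE; exact: measurable_ball_cV. Qed.

Lemma enorm2_unit_box x : unit_box x -> enorm x ^+ 2 <= n%:R.
Proof. by move=> x1; apply: enorm2_le_unit => i; exact/ltW/x1. Qed.

Lemma cst_le_integral_unit_box (c : R) : 0 <= c ->
  (c%:E <= \int[leb n]_(x in unit_box) c%:E)%E.
Proof.
move=> c0; rewrite integral_cst; last exact: measurable_unit_box.
have vol : leb n unit_box = ((1 *+ 2) ^+ n)%:E by rewrite unit_boxE lebesgue_cV_ball.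
rewrite [X in (_ <= _ * X)%E]vol -EFinM lee_fin ler_peMr// exprn_ege1//.
by rewrite mulr2n lerDl.
Qed.

(** If p x > q x, then p - q exceeds a third of p x - q x on a ball around x, which
    has positive volume. *)
Lemma continuous_density_le (p q : 'cV[R]_n -> R) : continuous p -> continuous q ->
  (forall x, 0 <= p x) -> (forall x, 0 <= q x) ->
  (forall A, measurable A -> measure_of_density p A = measure_of_density q A) ->
  forall x, p x <= q x.
Proof.
move=> cp cq p0 q0 pq x; rewrite leNgt; apply/negP => qpx.
pose e := (p x - q x) / 3.
have e0 : 0 < e by rewrite divr_gt0// subr_gt0.
have /cvgrPdist_lt/(_ _ e0)/nbhs_ballP[r1 /= r10 pr] := cp x.
have /cvgrPdist_lt/(_ _ e0)/nbhs_ballP[r2 /= r20 qr] := cq x.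
pose r := Num.min r1 r2; have r0 : 0 < r by rewrite lt_min r10.
have Br1 y : ball x r y -> `|p x - p y| < e.
  by move=> /(le_ball (_ : r <= r1)) /pr; apply; rewrite ge_min lexx.
have Br2 y : ball x r y -> `|q x - q y| < e.
  by move=> /(le_ball (_ : r <= r2)) /qr; apply; rewrite ge_min lexx orbT.
have mB := measurable_ball_cV x r.
have mp : measurable_fun setT (EFin \o p).
  by apply/measurable_EFinP; exact: measurable_fun_continuous_mx.
have mq : measurable_fun setT (EFin \o q).
  by apply/measurable_EFinP; exact: measurable_fun_continuous_mx.
have := pq _ mB; rewrite /measure_of_density => pqB.
have vol := lebesgue_cV_ball x r0.
have qfin : (\int[leb n]_(y in ball x r) (q y)%:E <= ((q x + e) * (r *+ 2) ^+ n)%:E)%E.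
  rewrite EFinM -vol -integral_cst//; apply: ge0_le_integral => //.
  - by move=> y _; rewrite lee_fin.
  - exact: measurable_funTS.
  - by move=> y /Br2; rewrite lee_fin ltr_norml => /andP[]; lra.
have pfin : (((p x - e) * (r *+ 2) ^+ n)%:E <= \int[leb n]_(y in ball x r) (p y)%:E)%E.
  rewrite EFinM -vol -integral_cst//; apply: ge0_le_integral => //.
  - move=> y _; rewrite lee_fin /e; have := q0 x; lra.
  - exact: measurable_funTS.
  - by move=> y /Br1; rewrite lee_fin ltr_norml => /andP[]; lra.
rewrite pqB in pfin; have := le_trans pfin qfin.
rewrite lee_fin ler_pM2r ?exprn_gt0 ?pmulrn_lgt0// /e; lra.
Qed.

Lemma continuous_density_unique (nu : set 'cV[R]_n -> \bar R) p :
  is_continuous_density nu p -> continuous_density nu = p.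
Proof.
move=> pd.
have qd := xgetPex (cst 0)
  (ex_intro _ p pd : exists q, [set p | is_continuous_density nu p] q).
have [cp p0 pnu] := pd; have [cq q0 qnu] := qd.
apply/funext => x; apply/eqP; rewrite eq_le; apply/andP; split.
  by apply: continuous_density_le => // A mA; rewrite -pnu// -qnu.
by apply: continuous_density_le => // A mA; rewrite -pnu// -qnu.
Qed.

End continuous_density_theory.

(** * Exponentials of quadratic polynomials on a fibre *)

Section line.
Context (R : realType).

Lemma one_sub_expRN_le (x y : R) : 0 <= x -> x <= `|y| ->
  1 - expR (- x) <= `|1 - expR (- y)|.
Proof.
move=> x0 xy; apply: (@le_trans _ _ (1 - expR (- `|y|))).
  by rewrite lerD2l lerN2 ler_expR lerN2.
have [y0|y0] := leP 0 y; first by rewrite ger0_norm// ler_norm.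
rewrite ltr0_norm// opprK distrC (le_trans _ (ler_norm _))//.
have := expR_ge1Dx y; have := expR_ge1Dx (- y); lra.
Qed.

Lemma one_sub_expRN_div7 (q : R) : 0 <= q ->
  1 - expR (- q) <= 7 * (1 - expR (- (q / 7))).
Proof.
move=> q0; set r := expR (- (q / 7)).
have -> : expR (- q) = r ^+ 7 by rewrite -expRM_natl; congr expR; field.
have r0 : 0 <= r by exact: expR_ge0.
have r1 : r <= 1 by rewrite -expR0 ler_expR oppr_le0 divr_ge0.
have -> : 1 - r ^+ 7 = (1 - r) * (\sum_(i < 7) r ^+ i).
  by rewrite !big_ord_recr big_ord0 /=; ring.
rewrite mulrC ler_wpM2r ?subr_ge0//.
have -> : 7 = \sum_(i < 7) (1 : R) by rewrite sumr_const card_ord.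
by apply: ler_sum => i _; exact: exprn_ile1.
Qed.

Definition expR_quad_dist (al a1 a2 be b1 b2 t : R) : R :=
  `|expR (al + t * a1 - t ^+ 2 * a2) - expR (be + t * b1 - t ^+ 2 * b2)|.

(** Here the first function is the larger one at 0 and has nonnegative slope there,
    so that on [0, 3] it stays above exp (- 9 L) times its value at 0. At one of the
    points 1, 2, 3 the log-ratio Q has at least 1/7 of its size at 0, because
    Q 0 = 3 Q 1 - 3 Q 2 + Q 3; there the relative difference of the two functions
    is at least 1/7 of the one at 0. *)
Let half (L al be a1 a2 b1 b2 : R) :
  be <= al -> 0 <= a1 -> 0 <= a2 <= L -> 0 <= L ->
  expR al - expR be <= 7 * expR (9 * L) *
    (expR_quad_dist al a1 a2 be b1 b2 1 + expR_quad_dist al a1 a2 be b1 b2 2 +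
     expR_quad_dist al a1 a2 be b1 b2 3).
Proof.
move=> ab a10 /andP[a20 a2L] L0; set D := expR_quad_dist al a1 a2 be b1 b2.
have D0 t : 0 <= D t by exact: normr_ge0.
pose Q t := (al + t * a1 - t ^+ 2 * a2) - (be + t * b1 - t ^+ 2 * b2).
pose q0 := al - be; have q00 : 0 <= q0 by rewrite subr_ge0.
have claim (t : R) : 0 <= t <= 3 -> q0 / 7 <= `|Q t| ->
    expR al - expR be <= 7 * expR (9 * L) * D t.
  move=> /andP[t0 t3] Qt.
  have -> : D t = expR (al + t * a1 - t ^+ 2 * a2) * `|1 - expR (- Q t)|.
    rewrite /D /expR_quad_dist -[X in _ = X * _]gtr0_norm ?expR_gt0// -normrM mulrBr mulr1 -expRD.
    by congr `| _ - expR _|; rewrite /Q; ring.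
  have fL : expR al <= expR (9 * L) * expR (al + t * a1 - t ^+ 2 * a2).
    rewrite -expRD ler_expR.
    have t29 : t ^+ 2 <= 9 by rewrite (_ : 9 = 3 ^+ 2) ?lerXn2r ?nnegrE//; ring.
    have : t ^+ 2 * a2 <= 9 * L by rewrite ler_pM ?sqr_ge0.
    have : 0 <= t * a1 by rewrite mulr_ge0.
    lra.
  have -> : expR al - expR be = expR al * (1 - expR (- q0)).
    by rewrite mulrBr mulr1 -expRD; congr (_ - expR _); rewrite /q0; ring.
  rewrite (_ : 7 * expR (9 * L) * _ = (expR (9 * L) *
    expR (al + t * a1 - t ^+ 2 * a2)) * (7 * `|1 - expR (- Q t)|)); last by ring.
  apply: ler_pM => //.
  - by rewrite subr_ge0 -expR0 ler_expR oppr_le0.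
  - rewrite (le_trans (one_sub_expRN_div7 q00))// ler_wpM2l//.
    by apply: one_sub_expRN_le => //; rewrite divr_ge0.
(* The third finite difference of a quadratic polynomial vanishes. *)
have QE : q0 = 3 * Q 1 - 3 * Q 2 + Q 3 by rewrite /q0 /Q; ring.
have c0 : 0 <= 7 * expR (9 * L) by rewrite mulr_ge0// expR_ge0.
have [h1|h1] := leP (q0 / 7) `|Q 1|.
  rewrite (le_trans (claim 1 _ h1))//; first by rewrite ler01/=; lra.
  by rewrite ler_wpM2l// -addrA lerDl addr_ge0.
have [h2|h2] := leP (q0 / 7) `|Q 2|.
  rewrite (le_trans (claim 2 _ h2))//; first by apply/andP; split; lra.
  by rewrite ler_wpM2l// addrAC lerDr addr_ge0.
have [h3|h3] := leP (q0 / 7) `|Q 3|.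
  rewrite (le_trans (claim 3 _ h3))//; first by apply/andP; split; lra.
  by rewrite ler_wpM2l// lerDr addr_ge0.
move: h1 h2 h3; rewrite !ltr_norml => /andP[? ?] /andP[? ?] /andP[? ?].
lra.
Qed.

(** Exchanging the two functions and reflecting t reduces to the previous case; the
    reflection is the reason for the negative sample points. The bound is uniform in
    the linear coefficients [a1] and [b1], which carry the position of the means. *)
Lemma expR_quadratic_diff_le (L al be a1 a2 b1 b2 : R) :
  0 <= a2 <= L -> 0 <= b2 <= L ->
  `|expR al - expR be| <= 7 * expR (9 * L) *
    \sum_(t <- [:: 1; 2; 3; -1; -2; -3]) expR_quad_dist al a1 a2 be b1 b2 t.
Proof.
move=> a2L b2L.
have L0 : 0 <= L by case/andP: a2L; exact: le_trans.
wlog ab : al be a1 b1 a2 b2 a2L b2L / be <= al.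
  move=> H; have [ab|/ltW ba] := leP be al; first exact: H.
  rewrite distrC (le_trans (H _ _ b1 a1 b2 a2 _ _ _))//.
  rewrite ler_wpM2l ?mulr_ge0 ?expR_ge0// le_eqVlt; apply/orP; left; apply/eqP.
  by apply: eq_bigr => t _; rewrite /expR_quad_dist distrC.
set D := expR_quad_dist al a1 a2 be b1 b2; rewrite ger0_norm ?subr_ge0 ?ler_expR//.
have D0 t : 0 <= D t by exact: normr_ge0.
have [a10|/ltW a10] := leP 0 a1.
  rewrite (le_trans (half b1 b2 ab a10 a2L L0))// ler_wpM2l ?mulr_ge0 ?expR_ge0//.
  rewrite !big_cons big_nil -/(D 1) -/(D 2) -/(D 3).
  have := D0 (-1); have := D0 (-2); have := D0 (-3); lra.
have a1N : 0 <= - a1 by rewrite oppr_ge0.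
rewrite (le_trans (half (- b1) b2 ab a1N a2L L0))// ler_wpM2l ?mulr_ge0 ?expR_ge0//.
have DN t : expR_quad_dist al (- a1) a2 be (- b1) b2 t = D (- t).
  by rewrite /D /expR_quad_dist sqrrN !mulrN !mulNr.
rewrite !DN !big_cons big_nil.
have := D0 1; have := D0 2; have := D0 3; lra.
Qed.

End line.

Section fibres.
Context (R : realType) (d K : nat).
Local Notation leb n := (@lebesgue_cV R n).
Implicit Types p g : 'cV[R]_(d + K) -> R.

(** On lines contained in a fibre {u} x R^K, log p is a quadratic polynomial, and L
    bounds its second-order coefficient for directions in the unit box. *)
Definition gauss_fibres (L : R) p := forall (x : 'cV[R]_(d + K)) (z : 'cV[R]_K),
  (forall i, `|z i 0| <= 1) -> exists b c : R, 0 <= c <= L /\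
    forall t, p (x + t *: col_mx 0 z) = p x * expR (t * b - t ^+ 2 * c).

Variables (L : R) (p g : 'cV[R]_(d + K) -> R).
Hypotheses (mp : measurable_fun setT p) (mg : measurable_fun setT g).
Hypotheses (p0 : forall x, 0 < p x) (g0 : forall x, 0 < g x).
Hypotheses (pL : gauss_fibres L p) (gL : gauss_fibres L g).

Lemma fibre_pointwise_le (u : 'cV[R]_d) (y z : 'cV[R]_K) :
  (forall i, `|z i 0| <= 1) ->
  `|p (col_mx u y) - g (col_mx u y)| <= 7 * expR (9 * L) *
    \sum_(t <- [:: 1; 2; 3; -1; -2; -3])
      `|p (col_mx u (y + t *: z)) - g (col_mx u (y + t *: z))|.
Proof.
move=> z1; have [a1 [a2 [a2L pE]]] := pL (col_mx u y) z1.
have [b1 [b2 [b2L gE]]] := gL (col_mx u y) z1.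
have lnp := lnK (p0 (col_mx u y)); have lng := lnK (g0 (col_mx u y)).
rewrite -{1}lnp -{1}lng (le_trans (expR_quadratic_diff_le _ _ a1 b1 a2L b2L))//.
rewrite le_eqVlt; apply/orP; left; apply/eqP; congr (_ * _).
apply: eq_bigr => t _.
have -> : col_mx u (y + t *: z) = col_mx u y + t *: col_mx 0 z.
  by rewrite scale_col_mx scaler0 add_col_mx addr0.
rewrite pE gE -{2}lnp -{2}lng -!expRD /expR_quad_dist.
by rewrite !addrA.
Qed.

(** Integrate the pointwise bound over z in the unit box, whose volume is at
    least 1. Replacing y + t z by z does not decrease an integral when |t| >= 1, and
    the six sample points t together give the factor 42 = 6 * 7. *)
Lemma fibre_sup_le (u : 'cV[R]_d) (y : 'cV[R]_K) :
  (`|p (col_mx u y) - g (col_mx u y)|%:E <= (42 * expR (9 * L))%:E *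
    \int[leb K]_y `|p (col_mx u y) - g (col_mx u y)|%:E)%E.
Proof.
pose D y : R := `|p (col_mx u y) - g (col_mx u y)|.
have D0 v : 0 <= D v by exact: normr_ge0.
have mD : measurable_fun setT D.
  apply: measurableT_comp => //; apply: measurable_funB;
    by apply: measurableT_comp => //; exact: measurable_col_mxl.
pose c := 7 * expR (9 * L); have c0 : 0 <= c by rewrite mulr_ge0 ?expR_ge0.
pose s : seq R := [:: 1; 2; 3; -1; -2; -3].
have mDt (t : R) : measurable_fun setT (fun z : 'cV[R]_K => (D (y + t *: z))%:E).
  apply/measurable_EFinP; apply: (measurableT_comp mD); exact: measurable_affine.
have int_t (t : R) : t \in s -> (\int[leb K]_z (D (y + t *: z))%:E <= \int[leb K]_z (D z)%:E)%E.
  move=> ts.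
  have t1 : 1 <= `|t|.
    by move: ts; rewrite !inE => /or3P[/eqP->|/eqP->|/or4P[]/eqP->];
      rewrite ?normrN ger0_norm//; lra.
  have t0 : t != 0 by rewrite -normr_gt0 (lt_le_trans ltr01).
  rewrite [leRHS](integral_cV_affine y t0)//; last by apply/measurable_EFinP.
  rewrite -[leLHS]mul1e lee_wpmul2r ?lee_fin ?exprn_ege1//.
  by apply: integral_ge0 => z _; rewrite lee_fin.
have -> : 42 * expR (9 * L) = c * 6 by rewrite /c; ring.
rewrite -/(D y); pose B := @unit_box R K.
have mB : measurable B by exact: measurable_unit_box.
apply: (@le_trans _ _ (\int[leb K]_(z in B) (D y)%:E)%E).
  exact: cst_le_integral_unit_box.
apply: (@le_trans _ _ (\int[leb K]_(z in B)
    (c%:E * (\sum_(t <- s) (D (y + t *: z))%:E)))%E).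
  apply: ge0_le_integral => //.
  - by move=> z _; rewrite lee_fin.
  - apply: measurable_funTS; apply: emeasurable_funM => //.
    by apply: emeasurable_sum => t _; exact: mDt.
  - move=> z z1; rewrite sumEFin -EFinM lee_fin; apply: fibre_pointwise_le => i.
    exact/ltW/z1.
apply: (@le_trans _ _ (\int[leb K]_z
    (c%:E * (\sum_(t <- s) (D (y + t *: z))%:E)))%E).
  apply: ge0_subset_integral => //.
  - apply: emeasurable_funM => //.
    by apply: emeasurable_sum => t _; exact: mDt.
  - by move=> z _; rewrite mule_ge0// sume_ge0// => t _; rewrite lee_fin.
rewrite ge0_integralZl//; last 2 first.
- by apply: emeasurable_sum => t _; exact: mDt.
- by move=> z _; rewrite sume_ge0// => t _; rewrite lee_fin.
rewrite ge0_integral_sum//; last by move=> t z _; rewrite lee_fin.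
rewrite [(c * 6)%:E]EFinM -muleA; apply: lee_wpmul2l; first by rewrite lee_fin.
apply: (@le_trans _ _ (\sum_(t <- s) \int[leb K]_z (D z)%:E)%E).
  by rewrite !big_seq; apply: lee_sum => t; exact: int_t.
set J := (\int[leb K]_y `|p (col_mx u y) - g (col_mx u y)|%:E)%E.
rewrite -/J big_const_seq count_predT /= addr0.
by rewrite [X in (_ <= X)%E](mule_natl J 6).
Qed.

Lemma fibre_integral_le (y : 'cV[R]_K) :
  (\int[leb d]_u ((1 + enorm u ^+ 2) * `|p (col_mx u y) - g (col_mx u y)|)%:E <=
   (42 * expR (9 * L))%:E *
   \int[leb (d + K)]_x ((1 + enorm x ^+ 2) * `|p x - g x|)%:E)%E.
Proof.
pose F x := ((1 + enorm x ^+ 2) * `|p x - g x|)%:E.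
have F0 x : (0 <= F x)%E by rewrite lee_fin mulr_ge0// ltW ?weight_gt0.
have mF : measurable_fun setT F.
  apply/measurable_EFinP; apply: measurable_funM; first exact: measurable_weight.
  by apply: measurableT_comp => //; exact: measurable_funB.
have mI : measurable_fun setT (fun u => \int[leb K]_y F (col_mx u y))%E.
  exact: measurable_integral_col_mx.
rewrite (integral_col_mx mF F0) -ge0_integralZl//; last first.
  by move=> u _; apply: integral_ge0.
apply: ge0_le_integral => //.
- by move=> u _; rewrite lee_fin mulr_ge0// ltW ?weight_gt0.
- apply/measurable_EFinP; apply: measurable_funM; first exact: measurable_weight.
  apply: measurableT_comp => //; apply: measurable_funB;
    by apply: measurableT_comp => //; exact: measurable_col_mxr.
- by apply: emeasurable_funM.
move=> u _.
have wu : 0 <= 1 + enorm u ^+ 2 by exact: ltW (weight_gt0 _).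
rewrite EFinM (le_trans (lee_wpmul2l _ (fibre_sup_le u y)))//.
rewrite muleCA; apply: lee_wpmul2l; first by rewrite lee_fin mulr_ge0 ?expR_ge0.
have mD : measurable_fun setT (fun v => `|p (col_mx u v) - g (col_mx u v)|%:E).
  apply/measurable_EFinP; apply: measurableT_comp => //; apply: measurable_funB;
    by apply: measurableT_comp => //; exact: measurable_col_mxl.
rewrite -ge0_integralZl//; apply: ge0_le_integral => //.
- by move=> v _; rewrite mule_ge0// lee_fin.
- by apply: emeasurable_funM.
- by apply: (measurableT_comp mF); exact: measurable_col_mxl.
- move=> v _; rewrite -EFinM lee_fin ler_wpM2r// enorm2_col_mx.
  by rewrite addrA lerDl sqr_ge0.
Qed.

End fibres.

(** * The distance as a weighted L^1 distance *)

Section dg_density.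
Context (R : realType) (n : nat).
Local Notation leb := (@lebesgue_cV R n).
Implicit Types p g : 'cV[R]_n -> R.

Definition gauss_dominated p : Prop :=
  exists2 Aa : R * R, 0 < Aa.2 & forall x, p x <= Aa.1 * gauss Aa.2 x.

Lemma gauss_dominated_integrable p (f : 'cV[R]_n -> R) :
  measurable_fun setT p -> (forall x, 0 <= p x) -> gauss_dominated p ->
  measurable_fun setT f -> (forall x, `|f x| <= 1 + enorm x ^+ 2) ->
  leb.-integrable setT (EFin \o (fun x => f x * p x)).
Proof.
move=> mp p0 [[A a] /= a0 pA] mf fw.
apply: (@integrable_gauss_le _ _ _ A a) => //; first exact: measurable_funM.
move=> x; rewrite normrM (ger0_norm (p0 x)) mulrCA; apply: ler_pM => //.
Qed.

(** Gaussian domination makes every test function integrable, so the two integrals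
    can be subtracted; f = (1 + |x|^2) sgn (p - g) attains the supremum. *)
Lemma dg_densityE p g : measurable_fun setT p -> measurable_fun setT g ->
  (forall x, 0 <= p x) -> (forall x, 0 <= g x) ->
  gauss_dominated p -> gauss_dominated g ->
  forall nu rho : set 'cV[R]_n -> \bar R,
  (forall A, measurable A -> nu A = measure_of_density p A) ->
  (forall A, measurable A -> rho A = measure_of_density g A) ->
  dg nu rho = (\int[leb]_x ((1 + enorm x ^+ 2) * `|p x - g x|)%:E)%E.
Proof.
move=> mp mg p0 g0 pd gd nu rho nuE rhoE.
have mw := @measurable_weight R n.
have mpg : measurable_fun setT (fun x => (1 + enorm x ^+ 2) * `|p x - g x|).
  by apply: measurable_funM => //; apply: measurableT_comp => //; exact: measurable_funB.
have diffE (f : 'cV[R]_n -> R) : measurable_fun [set: 'cV[R]_n] f ->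
    (forall x, `|f x| <= 1 + enorm x ^+ 2) ->
    (\int[nu]_x (f x)%:E - \int[rho]_x (f x)%:E =
     \int[leb]_x (f x * (p x - g x))%:E)%E.
  move=> mf fw; rewrite (integral_density mp p0 nuE mf) (integral_density mg g0 rhoE mf).
  rewrite -integralB_EFin//; last 2 first.
  - exact: gauss_dominated_integrable.
  - exact: gauss_dominated_integrable.
  by apply: eq_integral => x _; rewrite -EFinB mulrBr.
apply/eqP; rewrite eq_le; apply/andP; split.
  apply: ge_ereal_sup => _ [f [mf fw] <-]; rewrite diffE//.
  have mfpg : measurable_fun setT (fun x => f x * (p x - g x)).
    by apply: measurable_funM => //; exact: measurable_funB.
  apply: le_trans (le_abse_integral _ _ _) _ => //; first exact/measurable_EFinP.
  apply: ge0_le_integral => //.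
  - by apply/measurableT_comp => //; exact/measurable_EFinP.
  - exact/measurable_EFinP.
  - by move=> x _; rewrite /= lee_fin normrM ler_wpM2r.
pose f (x : 'cV[R]_n) : R := if g x <= p x then 1 + enorm x ^+ 2 else - (1 + enorm x ^+ 2).
have mf : measurable_fun setT f.
  apply: measurable_fun_ifT => //; first exact: measurable_fun_ler.
  exact: measurableT_comp.
have fw x : `|f x| <= 1 + enorm x ^+ 2.
  by rewrite /f; case: ifP => _; rewrite ?normrN ger0_norm// ltW ?weight_gt0.
apply: ereal_sup_ubound; exists f => //; rewrite diffE//.
rewrite (eq_integral (fun x => ((1 + enorm x ^+ 2) * `|p x - g x|)%:E)).
  rewrite gee0_abs//; apply: integral_ge0 => x _.
  by rewrite lee_fin mulr_ge0// ltW ?weight_gt0.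
move=> x _; congr EFin; rewrite /f; case: ifPn => gp.
  by rewrite ger0_norm// subr_ge0.
by rewrite -ltNge in gp; rewrite mulNr -mulrN ltr0_norm// subr_lt0.
Qed.

End dg_density.

(** * Normalization and conditioning *)

Section normalization.
Context (R : realType) (n : nat).
Local Notation leb := (@lebesgue_cV R n).
Variables (P G : 'cV[R]_n -> R) (A a z : R).
Hypotheses (mP : measurable_fun setT P) (mG : measurable_fun setT G).
Hypotheses (P0 : forall x, 0 <= P x) (G0 : forall x, 0 <= G x).
Hypotheses (a0 : 0 < a) (PA : forall x, P x <= A * gauss a x).
Hypotheses (dG : gauss_dominated G) (z0 : 0 < z).
Local Notation Zp := (fine (\int[leb]_x (P x)%:E)%E).
Local Notation Zg := (fine (\int[leb]_x (G x)%:E)%E).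
Hypotheses (zP : z <= Zp) (zG : z <= Zg).

Lemma normalization_weighted_L1_le :
  (\int[leb]_x ((1 + enorm x ^+ 2) * `|G x / Zg - P x / Zp|)%:E <=
   (z^-1 * (1 + A * gauss_moment n a * z^-1))%:E *
   \int[leb]_x ((1 + enorm x ^+ 2) * `|G x - P x|)%:E)%E.
Proof.
have mw := @measurable_weight R n.
have w0 (x : 'cV[R]_n) : 0 <= 1 + enorm x ^+ 2 by exact: ltW (weight_gt0 _).
have mGP : measurable_fun setT (fun x => `|G x - P x|).
  by apply: measurableT_comp => //; exact: measurable_funB.
have mwGP : measurable_fun setT (fun x => (1 + enorm x ^+ 2) * `|G x - P x|).
  exact: measurable_funM.
have dP : gauss_dominated P by exists (A, a).
have w1 (x : 'cV[R]_n) : `|1| <= 1 + enorm x ^+ 2 :> R by rewrite normr1 weight_ge1.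
have ww (x : 'cV[R]_n) : `|1 + enorm x ^+ 2| <= 1 + enorm x ^+ 2 :> R.
  by rewrite ger0_norm.
have iP : leb.-integrable setT (EFin \o P).
  have := gauss_dominated_integrable mP P0 dP (measurable_cst (1 : R)) w1.
  by under eq_fun do rewrite /= mul1r.
have iG : leb.-integrable setT (EFin \o G).
  have := gauss_dominated_integrable mG G0 dG (measurable_cst (1 : R)) w1.
  by under eq_fun do rewrite /= mul1r.
have iwP := gauss_dominated_integrable mP P0 dP mw ww.
have iwG := gauss_dominated_integrable mG G0 dG mw ww.
have iwGP : leb.-integrable setT (EFin \o (fun x => (1 + enorm x ^+ 2) * `|G x - P x|)).
  have := integrable_abse (integrableB measurableT iwG iwP).
  apply: eq_integrable => // x _ /=.
  by rewrite -mulrBr normrM (ger0_norm (w0 x)).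
pose I := \int[leb]_x ((1 + enorm x ^+ 2) * `|G x - P x|).
have IE : (\int[leb]_x ((1 + enorm x ^+ 2) * `|G x - P x|)%:E = I%:E)%E.
  by rewrite fineK//; exact: integrable_fin_num.
have Zp0 : 0 < Zp by exact: lt_le_trans zP.
have Zg0 : 0 < Zg by exact: lt_le_trans zG.
have w1le (x : 'cV[R]_n) r : 0 <= r -> r <= (1 + enorm x ^+ 2) * r.
  by move=> r0; rewrite ler_peMl// weight_ge1.
have ZI : `|Zg - Zp| <= I.
  rewrite -lee_fin -IE -abse_EFin EFinB !fineK; last 2 first.
  - exact: integrable_fin_num.
  - exact: integrable_fin_num.
  rewrite -integralB_EFin//.
  apply: le_trans (le_abse_integral _ _ _) _ => //.
    by apply/measurable_EFinP; exact: measurable_funB.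
  apply: ge0_le_integral => //.
  - by apply/measurableT_comp => //; apply/measurable_EFinP; exact: measurable_funB.
  - exact/measurable_EFinP.
  - by move=> x _; rewrite -EFinB abse_EFin lee_fin w1le.
have I0 : 0 <= I by exact: le_trans ZI.
have wPM : (\int[leb]_x ((1 + enorm x ^+ 2) * P x)%:E <= (A * gauss_moment n a)%:E)%E.
  rewrite EFinM -integral_weight_gauss// -ge0_integralZl//; last 3 first.
  - apply/measurable_EFinP; apply: measurable_funM => //; exact: measurable_gauss.
  - by move=> x _; rewrite lee_fin mulr_ge0// gauss_ge0.
  - have := le_trans (P0 0) (PA 0); rewrite pmulr_lge0 ?gauss_gt0//.
  apply: ge0_le_integral => //.
  - by move=> x _; rewrite lee_fin mulr_ge0.
  - by apply/measurable_EFinP; exact: measurable_funM.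
  - apply: emeasurable_funM => //; apply/measurable_EFinP.
    by apply: measurable_funM => //; exact: measurable_gauss.
  - by move=> x _; rewrite -EFinM lee_fin mulrCA ler_wpM2l.
have z1 : 0 <= z^-1 by rewrite invr_ge0 ltW.
have Zgz : Zg^-1 <= z^-1 by rewrite lef_pV2// posrE.
have Zpz : Zp^-1 <= z^-1 by rewrite lef_pV2// posrE.
apply: (@le_trans _ _ (\int[leb]_x ((z^-1)%:E * ((1 + enorm x ^+ 2) * `|G x - P x|)%:E +
    (z^-1 * z^-1 * I)%:E * ((1 + enorm x ^+ 2) * P x)%:E))%E).
  apply: ge0_le_integral => //.
  - by move=> x _; rewrite lee_fin mulr_ge0.
  - apply/measurable_EFinP; apply: measurable_funM => //; apply: measurableT_comp => //.
    by apply: measurable_funB => //; apply: measurable_funM.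
  - apply: emeasurable_funD; apply: emeasurable_funM => //; apply/measurable_EFinP => //.
    exact: measurable_funM.
  move=> x _; rewrite -!EFinM -EFinD lee_fin.
  have -> : z^-1 * ((1 + enorm x ^+ 2) * `|G x - P x|) +
    z^-1 * z^-1 * I * ((1 + enorm x ^+ 2) * P x) =
    (1 + enorm x ^+ 2) * (z^-1 * `|G x - P x| + z^-1 * z^-1 * I * P x) by ring.
  rewrite ler_wpM2l//.
  have -> : G x / Zg - P x / Zp = Zg^-1 * (G x - P x) + Zg^-1 * Zp^-1 * (Zp - Zg) * P x.
    by field; rewrite !gt_eqF.
  rewrite (le_trans (ler_normD _ _))// !normrM !normfV !(gtr0_norm Zp0) !(gtr0_norm Zg0).
  rewrite (ger0_norm (P0 x)) lerD// ler_wpM2r//.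
  rewrite ler_pM ?mulr_ge0 ?invr_ge0 ?(ltW Zp0) ?(ltW Zg0)//; last by rewrite distrC.
  by rewrite ler_pM ?invr_ge0 ?(ltW Zp0) ?(ltW Zg0).
rewrite ge0_integralD//; last 4 first.
- by move=> x _; rewrite -EFinM lee_fin !mulr_ge0.
- by apply: emeasurable_funM => //; exact/measurable_EFinP.
- by move=> x _; rewrite -EFinM lee_fin !mulr_ge0.
- by apply: emeasurable_funM => //; apply/measurable_EFinP; exact: measurable_funM.
rewrite !ge0_integralZl//; last 5 first.
- by apply/measurable_EFinP; exact: measurable_funM.
- by move=> x _; rewrite lee_fin !mulr_ge0.
- by rewrite lee_fin !mulr_ge0.
- exact/measurable_EFinP.
- by move=> x _; rewrite lee_fin !mulr_ge0.
rewrite IE; apply: (@le_trans _ _ ((z^-1)%:E * I%:E +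
    (z^-1 * z^-1 * I)%:E * (A * gauss_moment n a)%:E)%E).
  by rewrite leeD2l// lee_wpmul2l// lee_fin !mulr_ge0.
by rewrite -!EFinM -EFinD lee_fin le_eqVlt; apply/orP; left; apply/eqP; ring.
Qed.

End normalization.

Section conditioning.
Context (R : realType) (d K : nat).
Local Notation leb n := (@lebesgue_cV R n).
Implicit Types p g : 'cV[R]_(d + K) -> R.

Lemma slice_dominated p (y : 'cV[R]_K) : (forall x, 0 <= p x) ->
  gauss_dominated p -> gauss_dominated (fun u => p (col_mx u y)).
Proof.
move=> p0 [[A a] /= a0 pA]; exists (A * gauss a y, a) => // u /=.
by rewrite mulrAC -mulrA -gauss_col_mx.
Qed.

Definition slice_mass p (y : 'cV[R]_K) : R :=
  fine (\int[leb d]_u (p (col_mx u y))%:E)%E.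

(** The lower Gaussian bound is integrated over the unit box, where |u|^2 <= d. *)
Lemma slice_mass_ge p (y : 'cV[R]_K) (c b k : R) :
  measurable_fun setT p -> gauss_dominated p -> 0 < c -> 0 <= b ->
  (forall x, c * gauss b x <= p x) -> enorm y <= k ->
  c * expR (- (b * (d%:R + k ^+ 2))) <= slice_mass p y.
Proof.
move=> mp dp c0 b0 pc yk.
have p0 x : 0 <= p x by rewrite (le_trans _ (pc x))// mulr_ge0 ?gauss_ge0// ltW.
have ms : measurable_fun setT (fun u => p (col_mx u y)).
  by apply: measurableT_comp => //; exact: measurable_col_mxr.
have ints : (leb d).-integrable setT (EFin \o (fun u => p (col_mx u y))).
  have w1 (x : 'cV[R]_d) : `|1| <= 1 + enorm x ^+ 2 :> R by rewrite normr1 weight_ge1.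
  have := gauss_dominated_integrable ms (fun u => p0 _) (slice_dominated y p0 dp)
    (measurable_cst (1 : R)) w1.
  by under eq_fun do rewrite /= mul1r.
rewrite -lee_fin fineK; last exact: integrable_fin_num.
set m := c * _; have m0 : 0 <= m by rewrite mulr_ge0 ?expR_ge0// ltW.
apply: (le_trans (@cst_le_integral_unit_box R d _ m0)).
have mB := @measurable_unit_box R d.
apply: (@le_trans _ _ (\int[leb d]_(u in unit_box (n:=d)) (p (col_mx u y))%:E)%E).
  apply: ge0_le_integral => //.
  - by apply: measurable_funTS; exact/measurable_EFinP.
  - move=> u /enorm2_unit_box uB; rewrite lee_fin (le_trans _ (pc _))//.
    rewrite ler_wpM2l ?(ltW c0)// ler_expR lerN2 ler_wpM2l// enorm2_col_mx lerD//.
    by rewrite lerXn2r ?nnegrE ?enorm_ge0// (le_trans (enorm_ge0 y)).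
apply: ge0_subset_integral => //; first exact/measurable_EFinP.
by move=> u _; rewrite lee_fin.
Qed.

(** The number z is the lower bound of [slice_mass_ge] for the masses of the slices;
    the first two factors come from normalizing them, the last one from
    [fibre_integral_le]. *)
Definition conditioning_cst (A a c b L k : R) : R :=
  let z := c * expR (- (b * (d%:R + k ^+ 2))) in
  z^-1 * (1 + A * gauss_moment d a * z^-1) * (42 * expR (9 * L)).

Lemma conditioning_weighted_L1_le p g (y : 'cV[R]_K) (A a c b L k : R) :
  measurable_fun setT p -> measurable_fun setT g ->
  0 < a -> (forall x, p x <= A * gauss a x) -> gauss_dominated g ->
  0 < c -> 0 <= b ->
  (forall x, c * gauss b x <= p x) -> (forall x, c * gauss b x <= g x) ->
  gauss_fibres L p -> gauss_fibres L g -> enorm y <= k ->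
  (\int[leb d]_u ((1 + enorm u ^+ 2) *
     `|g (col_mx u y) / slice_mass g y - p (col_mx u y) / slice_mass p y|)%:E <=
   (conditioning_cst A a c b L k)%:E *
   \int[leb (d + K)]_x ((1 + enorm x ^+ 2) * `|g x - p x|)%:E)%E.
Proof.
move=> mp mg a0 pA dg c0 b0 pc gc pL gL yk.
have lb0 (x : 'cV[R]_(d + K)) : 0 < c * gauss b x by rewrite mulr_gt0 ?gauss_gt0.
have p0 x : 0 < p x by exact: lt_le_trans (lb0 x) (pc x).
have g0 x : 0 < g x by exact: lt_le_trans (lb0 x) (gc x).
have dp : gauss_dominated p by exists (A, a).
have A0 : 0 <= A by have := le_trans (ltW (p0 0)) (pA 0); rewrite pmulr_lge0// gauss_gt0.
have ms q : measurable_fun setT q ->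
    measurable_fun [set: 'cV[R]_d] (fun u => q (col_mx u y) : R).
  by move=> mq; apply: measurableT_comp => //; exact: measurable_col_mxr.
pose z := c * expR (- (b * (d%:R + k ^+ 2))).
have z0 : 0 < z by rewrite mulr_gt0// expR_gt0.
apply: (le_trans (@normalization_weighted_L1_le _ _ (fun u => p (col_mx u y))
  (fun u => g (col_mx u y)) A a z (ms _ mp) (ms _ mg) (fun u => ltW (p0 _))
  (fun u => ltW (g0 _)) a0 _ _ z0 _ _)).
- move=> u; rewrite (le_trans (pA _))// ler_wpM2l// gauss_col_mx ler_piMr ?gauss_ge0//.
  by rewrite gauss_le1// ltW.
- by apply: slice_dominated => // x; exact: ltW.
- exact: slice_mass_ge.
- exact: slice_mass_ge.
rewrite [X in (_ <= X%:E * _)%E]/conditioning_cst -/z [X in (_ <= X * _)%E]EFinM -[leRHS]muleA.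
apply: lee_wpmul2l; last exact: fibre_integral_le.
rewrite lee_fin mulr_ge0 ?invr_ge0 ?(ltW z0)// addr_ge0//.
by rewrite !mulr_ge0 ?gauss_moment_ge0// invr_ge0 ltW.
Qed.

End conditioning.

(** * Mean and covariance under Gaussian bounds *)

Section moments.
Context (R : realType) (n : nat).
Local Notation leb := (@lebesgue_cV R n).
Variables (p : 'cV[R]_n -> R) (nu : set 'cV[R]_n -> \bar R) (A a : R).
Hypotheses (mp : measurable_fun setT p) (p0 : forall x, 0 <= p x).
Hypotheses (nuE : forall A, measurable A -> nu A = measure_of_density p A).
Hypotheses (a0 : 0 < a) (pA : forall x, p x <= A * gauss a x).

Let A0 : 0 <= A.
Proof. by have := le_trans (p0 0) (pA 0); rewrite pmulr_lge0// gauss_gt0. Qed.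

Lemma quadratic_integrable (f : 'cV[R]_n -> R) (k : R) : measurable_fun setT f ->
  (forall x, `|f x| <= k * (1 + enorm x ^+ 2)) ->
  leb.-integrable setT (EFin \o (fun x => f x * p x)).
Proof.
move=> mf fk; apply: (@integrable_gauss_le _ _ _ (k * A) a) => //.
  exact: measurable_funM.
move=> x; rewrite normrM (ger0_norm (p0 x)).
by rewrite (_ : _ * A * _ = k * (1 + enorm x ^+ 2) * (A * gauss a x)) ?ler_pM//; ring.
Qed.

Lemma quadratic_integral_le (f : 'cV[R]_n -> R) (k : R) : measurable_fun setT f ->
  (forall x, `|f x| <= k * (1 + enorm x ^+ 2)) ->
  `|fine (\int[nu]_x (f x)%:E)%E| <= k * (A * gauss_moment n a).
Proof.
move=> mf fk; rewrite (integral_density mp p0 nuE mf).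
have fi := quadratic_integrable mf fk.
have k0 : 0 <= k.
  by have := le_trans (normr_ge0 _) (fk 0); rewrite pmulr_lge0// weight_gt0.
have mw := @measurable_weight R n; have mga := @measurable_gauss R n a.
rewrite -lee_fin -abse_EFin fineK; last exact: integrable_fin_num.
apply: le_trans (le_abse_integral _ _ _) _ => //.
  by apply/measurable_EFinP; exact: measurable_funM.
rewrite mulrA EFinM -integral_weight_gauss// -ge0_integralZl//; last 3 first.
- by apply/measurable_EFinP; exact: measurable_funM.
- by move=> x _; rewrite lee_fin mulr_ge0 ?gauss_ge0// ltW ?weight_gt0.
- by rewrite lee_fin mulr_ge0.
apply: ge0_le_integral => //.
- by apply: measurableT_comp => //; apply/measurable_EFinP; exact: measurable_funM.
- by apply: emeasurable_funM => //; apply/measurable_EFinP; exact: measurable_funM.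
- move=> x _; rewrite -EFinM abse_EFin lee_fin normrM (ger0_norm (p0 x)).
  by rewrite (_ : _ * A * _ = k * (1 + enorm x ^+ 2) * (A * gauss a x)) ?ler_pM//; ring.
Qed.

Local Notation M := (A * gauss_moment n a).

Lemma normr_le_weight (x : 'cV[R]_n) i : `|x i 0| <= 1 + enorm x ^+ 2.
Proof.
have := coord_le_enorm2 x i; rewrite -real_normK ?num_real//.
have := sqr_ge0 (`|x i 0| - 2^-1); move: `|x i 0| => r; lra.
Qed.

Lemma mean_le i : `|mean nu i 0| <= M.
Proof.
rewrite mxE -[leRHS]mul1r; apply: quadratic_integral_le.
  exact: measurable_coord_mx.
by move=> x; rewrite mul1r normr_le_weight.
Qed.

Let M0 : 0 <= M. Proof. by rewrite mulr_ge0 ?gauss_moment_ge0. Qed.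

Let mcov i j : measurable_fun setT
  (fun x : 'cV[R]_n => (x i 0 - mean nu i 0) * (x j 0 - mean nu j 0)).
Proof.
by apply: measurable_funM; apply: measurable_funB => //; exact: measurable_coord_mx.
Qed.

Let cov_integrand_le i j (x : 'cV[R]_n) :
  `|(x i 0 - mean nu i 0) * (x j 0 - mean nu j 0)| <=
  2 * (1 + M ^+ 2) * (1 + enorm x ^+ 2).
Proof.
have h k : (x k 0 - mean nu k 0) ^+ 2 <= 2 * enorm x ^+ 2 + 2 * M ^+ 2.
  have := coord_le_enorm2 x k; have := mean_le k; rewrite ler_norml => /andP[].
  move: (x k 0) (mean nu k 0) (enorm x ^+ 2) => r m e ? ? re.
  have : m ^+ 2 <= M ^+ 2.
    by rewrite -subr_ge0 subr_sqr mulr_ge0 ?subr_ge0//; lra.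
  have := sqr_ge0 (r + m); nra.
have M20 := sqr_ge0 M; have e0 := sqr_ge0 (enorm x).
have := h i; have := h j; move: (x i 0 - _) (x j 0 - _) => r s sM rM.
have : `|r * s| <= (r ^+ 2 + s ^+ 2) / 2.
  rewrite ler_norml; have := sqr_ge0 (r - s); have := sqr_ge0 (r + s) => ? ?.
  by apply/andP; split; nra.
nra.
Qed.

Lemma cov_le i j : `|cov nu i j| <= 2 * (1 + M ^+ 2) * M.
Proof. by rewrite mxE; exact: quadratic_integral_le. Qed.

Lemma cov_sym : (cov nu)^T = cov nu.
Proof.
apply/matrixP => i j; rewrite mxE [LHS]mxE [RHS]mxE; congr fine.
by congr (integral _ _ _); apply/funext => x; rewrite mulrC.
Qed.

Lemma cov_quadratic_form (v : 'cV[R]_n) :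
  ((v^T *m cov nu *m v) 0 0)%:E =
  (\int[leb]_x ((\sum_i v i 0 * (x i 0 - mean nu i 0)) ^+ 2 * p x)%:E)%E.
Proof.
have -> : (v^T *m cov nu *m v) 0 0 = \sum_i \sum_j v i 0 * v j 0 * cov nu i j.
  rewrite mxE exchange_big; apply: eq_bigr => j _.
  rewrite mxE mulr_suml; apply: eq_bigr => i _; rewrite !mxE; ring.
rewrite (eq_integral (fun x : 'cV[R]_n => \sum_i \sum_j (v i 0 * v j 0)%:E *
   ((x i 0 - mean nu i 0) * (x j 0 - mean nu j 0) * p x)%:E)%E); last first.
  move=> x _; rewrite expr2 !mulr_suml -sumEFin; apply: eq_bigr => i _.
  rewrite mulr_sumr mulr_suml -sumEFin; apply: eq_bigr => j _.
  by rewrite -EFinM; congr EFin; ring.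
have ic i j := quadratic_integrable (mcov i j) (cov_integrand_le i j).
rewrite integral_sum//; last first.
  by move=> i; apply: integrable_sum => // j _; apply: integrableZl => //; exact: ic.
rewrite -sumEFin; apply: eq_bigr => i _.
rewrite integral_sum//; last by move=> j; apply: integrableZl => //; exact: ic.
rewrite -sumEFin; apply: eq_bigr => j _.
rewrite integralZl//; last exact: ic.
rewrite mxE EFinM; congr (_ * _)%E.
by rewrite (integral_density mp p0 nuE (mcov i j)) fineK//; exact: integrable_fin_num (ic i j).
Qed.

(** Translating x by the i-th basis vector changes ell(x) = v . (x - m) by v_i, and
    r^2 + (r + s)^2 >= s^2 / 2. So, wherever the mean m is, ell^2 and its translate
    add up to at least v_i^2 / 2. This is integrated over the unit box: the box and
    its translate lie in |x|^2 <= 4 n, where p >= c exp (- 4 b n). *)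
Lemma cov_coercive (c b : R) : (0 < n)%N -> 0 < c -> 0 <= b ->
  (forall x, c * gauss b x <= p x) ->
  forall v : 'cV[R]_n, c * expR (- (b * (4 * n%:R))) / (4 * n%:R) * enorm v ^+ 2 <=
    (v^T *m cov nu *m v) 0 0.
Proof.
move=> n0 c0 b0 pc v; set q := (_ *m v) 0 0; set c' := c * _.
pose ell (x : 'cV[R]_n) := \sum_i v i 0 * (x i 0 - mean nu i 0).
pose F x := (ell x ^+ 2 * p x)%:E.
have qE : q%:E = (\int[leb]_x F x)%E by exact: cov_quadratic_form.
have mell : measurable_fun setT ell.
  apply: measurable_sum => i; apply: measurable_funM => //.
  by apply: measurable_funB => //; exact: measurable_coord_mx.
have mF : measurable_fun setT F.
  by apply/measurable_EFinP; apply: measurable_funM => //; exact: measurable_funX.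
have F0 x : (0 <= F x)%E by rewrite lee_fin mulr_ge0 ?sqr_ge0.
have c'0 : 0 < c' by rewrite mulr_gt0// expR_gt0.
have mB := @measurable_unit_box R n.
have coord i : c' / 4 * v i 0 ^+ 2 <= q.
  pose e : 'cV[R]_n := delta_mx i 0.
  have ellD x : ell (e + 1 *: x) = ell x + v i 0.
    have eD j : (e + 1 *: x) j 0 = (j == i)%:R + x j 0.
      by rewrite scale1r mxE [e _ _]mxE eqxx andbT.
    rewrite /ell (bigD1 i)//= [in RHS](bigD1 i)//= eD eqxx.
    rewrite (eq_bigr (fun j => v j 0 * (x j 0 - mean nu j 0))) => [|j ji]; last first.
      by rewrite eD (negbTE ji) add0r.
    by rewrite mulr1n; set s := \sum_(j < n | _) _; ring.
  have mFe : measurable_fun setT (fun x : 'cV[R]_n => F (e + 1 *: x)).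
    by apply: (measurableT_comp mF); exact: measurable_affine.
  have pB x : enorm x ^+ 2 <= 4 * n%:R -> c' <= p x.
    by move=> xn; rewrite (le_trans _ (pc x))// ler_wpM2l ?(ltW c0)// ler_expR lerN2 ler_wpM2l.
  have n1 : 1 <= n%:R :> R by rewrite ler1n.
  suff : ((c' * (v i 0 ^+ 2 / 2))%:E <= q%:E + q%:E)%E by rewrite -EFinD lee_fin; lra.
  apply: (le_trans (@cst_le_integral_unit_box R n _ _)).
    by rewrite mulr_ge0 ?(ltW c'0)// divr_ge0// sqr_ge0.
  apply: (@le_trans _ _ (\int[leb]_(x in unit_box (n:=n)) (F x + F (e + 1 *: x)%R))%E).
    apply: ge0_le_integral => //.
    - by move=> x _; rewrite lee_fin mulr_ge0 ?(ltW c'0)// divr_ge0// sqr_ge0.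
    - by apply: measurable_funTS; exact: emeasurable_funD.
    move=> x /enorm2_unit_box xn; rewrite -EFinD lee_fin ellD.
    have p1 : c' <= p x by apply: pB; lra.
    have p2 : c' <= p (e + 1 *: x).
      apply: pB; rewrite scale1r (le_trans (enorm2_add_le _ _))//.
      have -> : enorm e ^+ 2 = 1.
        rewrite enorm2E (bigD1 i)//= big1 => [|j ji]; first by rewrite mxE !eqxx expr1n addr0.
        by rewrite mxE (negbTE ji) expr0n.
      lra.
    have := sqr_ge0 (2 * ell x + v i 0); move: (ell x) (v i 0) => r s rs.
    have : c' * r ^+ 2 <= r ^+ 2 * p x by rewrite mulrC ler_wpM2l ?sqr_ge0.
    have : c' * (r + s) ^+ 2 <= (r + s) ^+ 2 * p (e + 1 *: x) by rewrite mulrC ler_wpM2l ?sqr_ge0.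
    have : c' * (s ^+ 2 / 2) <= c' * (r ^+ 2 + (r + s) ^+ 2) by rewrite ler_wpM2l ?(ltW c'0)//; lra.
    lra.
  apply: (@le_trans _ _ (\int[leb]_x (F x + F (e + 1 *: x)%R))%E).
    apply: ge0_subset_integral => //; first exact: emeasurable_funD.
    by move=> x _; rewrite adde_ge0.
  rewrite ge0_integralD// qE leeD2l//.
  by rewrite [leRHS](integral_cV_affine e (oner_neq0 R))// normr1 expr1n mul1e.
rewrite mulrAC ler_pdivrMr ?mulr_gt0 ?ltr0n//.
have : \sum_i c' / 4 * v i 0 ^+ 2 <= \sum_(i < n) q by apply: ler_sum => i _; exact: coord.
rewrite sumr_const card_ord -mulr_sumr -enorm2E -mulr_natr; lra.
Qed.

End moments.

(** * Gaussian kernels *)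

Section continuity.
Context (R : realType).

Lemma continuous_fun_comp (T U V : topologicalType) (f : T -> U) (g : U -> V) :
  continuous f -> continuous g -> continuous (fun x => g (f x)).
Proof. by move=> cf cg x; apply: (continuous_comp (cf x)); exact: cg. Qed.

Lemma continuous_sumr (T : topologicalType) (I : Type) (s : seq I) (f : I -> T -> R) :
  (forall i, continuous (f i)) -> continuous (fun x => \sum_(i <- s) f i x).
Proof.
move=> cf x; elim: s => [|i s IH].
  by under eq_fun do rewrite big_nil; exact: cvg_cst.
under eq_fun do rewrite big_cons.
by apply: cvgD; [exact: cf|exact: IH].
Qed.

Lemma continuous_fun_sub (T : topologicalType) (f g : T -> R) :
  continuous f -> continuous g -> continuous (fun x => f x - g x).
Proof. by move=> cf cg x; apply: cvgB; [exact: cf|exact: cg]. Qed.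

Lemma continuous_fun_mul (T : topologicalType) (f g : T -> R) :
  continuous f -> continuous g -> continuous (fun x => f x * g x).
Proof. by move=> cf cg x; apply: cvgM; [exact: cf|exact: cg]. Qed.

Lemma continuous_wnorm2 n (T : topologicalType) (S : 'M[R]_n) (w : T -> 'cV[R]_n) :
  (forall i, continuous (fun x => w x i 0)) ->
  continuous (fun x => wnorm S (w x) ^+ 2).
Proof.
move=> cw; under eq_fun do rewrite /wnorm enorm2E.
apply: continuous_sumr => i.
under eq_fun do rewrite mxE expr2.
have cs : continuous (fun x => \sum_j invmx (sqrtmx S) i j * w x j 0).
  apply: continuous_sumr => j x; apply: cvgM; [exact: cvg_cst|exact: cw].
by move=> x; apply: cvgM; exact: cs.
Qed.

Lemma continuous_usubmx m n : continuous (@usubmx R m n 1).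
Proof.
move=> x U /nbhs_ballP[e /= e0 eU]; apply/nbhs_ballP; exists e => // y [_ xy].
by apply: eU; split=> // i j; rewrite !mxE; exact: xy.
Qed.

Lemma continuous_coord n i : continuous (fun x : 'cV[R]_n => x i 0).
Proof. exact: coord_continuous. Qed.

Lemma continuous_gaussian_kernel n (T : topologicalType) (S : 'M[R]_n) (w : T -> 'cV[R]_n) :
  (forall i, continuous (fun x => w x i 0)) ->
  continuous (fun x => expR (- (2^-1 * wnorm S (w x) ^+ 2))).
Proof.
move=> cw x; apply: (continuous_comp (f := fun x => - (2^-1 * wnorm S (w x) ^+ 2)));
  last exact: continuous_expR.
by apply: cvgN; apply: cvgM; [exact: cvg_cst|exact: continuous_wnorm2].
Qed.

End continuity.

Section gauss_pdf_theory.
Context (R : realType) (n : nat).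
Implicit Types (S : 'M[R]_n) (x m : 'cV[R]_n).

Definition gauss_peak S : R := (Num.sqrt ((2 * pi) ^+ n * \det S))^-1.

Lemma gauss_peak_gt0 S : posdefmx S -> 0 < gauss_peak S.
Proof.
move=> Spd; rewrite invr_gt0 sqrtr_gt0 mulr_gt0 ?posdefmx_det_gt0//.
by rewrite exprn_gt0// mulr_gt0// pi_gt0.
Qed.

Definition gauss_kernel S m x : R := expR (- (2^-1 * wnorm S (x - m) ^+ 2)).

Lemma gauss_kernel_le S (a k : R) m x : 0 < a ->
  (forall v, a * enorm v ^+ 2 <= wnorm S v ^+ 2) -> enorm m <= k ->
  gauss_kernel S m x <= expR (a * k ^+ 2) * gauss (a / 4) x.
Proof.
move=> a0 aS mk; rewrite -expRD ler_expR.
have := aS (x - m); have := enorm2_add_le (x - m) m; rewrite subrK.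
have : enorm m ^+ 2 <= k ^+ 2 by rewrite lerXn2r ?nnegrE ?enorm_ge0// (le_trans (enorm_ge0 m)).
have := sqr_ge0 k.
move: (enorm _ ^+ 2) (enorm _ ^+ 2) (enorm _ ^+ 2) (wnorm _ _ ^+ 2) (k ^+ 2) => X Y Z W k2; nra.
Qed.

Lemma gauss_kernel_ge S (b k : R) m x : 0 <= b ->
  (forall v, wnorm S v ^+ 2 <= b * enorm v ^+ 2) -> enorm m <= k ->
  expR (- (b * k ^+ 2)) * gauss b x <= gauss_kernel S m x.
Proof.
move=> b0 bS mk; rewrite -expRD ler_expR.
have := bS (x - m); have := enorm2_add_le x (- m); rewrite enormN.
have : enorm m ^+ 2 <= k ^+ 2 by rewrite lerXn2r ?nnegrE ?enorm_ge0// (le_trans (enorm_ge0 m)).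
move: (enorm _ ^+ 2) (enorm _ ^+ 2) (enorm _ ^+ 2) (wnorm _ _ ^+ 2) (k ^+ 2) => X Y Z W k2; nra.
Qed.

Lemma gauss_kernel_line S m x z : exists b : R, forall t : R,
  gauss_kernel S m (x + t *: z) =
  gauss_kernel S m x * expR (t * b - t ^+ 2 * (2^-1 * wnorm S z ^+ 2)).
Proof.
have [b bE] := wnorm_line S (x - m) z; exists (- (b / 2)) => t.
by rewrite /gauss_kernel addrAC bE -expRD; congr expR; field.
Qed.

Lemma gauss_pdf_line S m x z : exists b : R, forall t : R,
  gauss_pdf m S (x + t *: z) =
  gauss_pdf m S x * expR (t * b - t ^+ 2 * (2^-1 * wnorm S z ^+ 2)).
Proof.
have [b bE] := gauss_kernel_line S m x z; exists b => t.
rewrite -[LHS]/(gauss_peak S * gauss_kernel S m (x + t *: z)) bE.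
by rewrite mulrA.
Qed.

Lemma continuous_gauss_kernel S m : continuous (gauss_kernel S m).
Proof.
apply: continuous_gaussian_kernel => i.
under eq_fun do rewrite !mxE.
by apply: continuous_fun_sub; [exact: continuous_coord|exact: cst_continuous].
Qed.

Lemma continuous_gauss_pdf S m : continuous (gauss_pdf m S).
Proof.
apply: continuous_fun_mul; last exact: continuous_gauss_kernel.
exact: cst_continuous.
Qed.

Lemma gauss_pdf_gt0 S m x : posdefmx S -> 0 < gauss_pdf m S x.
Proof. by move=> Spd; rewrite mulr_gt0 ?gauss_peak_gt0// expR_gt0. Qed.

(** The bound is uniform in the centre m of the kernel, |m| <= k. Hence it survives
    averaging over m, and the averaged kernel is continuous. *)
Lemma gauss_kernel_lipschitz S (b k r : R) m x y :
  (forall v, wnorm S v ^+ 2 <= b * enorm v ^+ 2) -> enorm m <= k ->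
  0 <= b -> 0 <= r <= 1 -> enorm (y - x) ^+ 2 <= n%:R * r ^+ 2 ->
  `|gauss_kernel S m x - gauss_kernel S m y| <=
  r * (1 + b ^+ 2 * n%:R * (16 * enorm x ^+ 2 + 4 * n%:R + 8 * k ^+ 2)).
Proof.
move=> bS mk b0 /andP[r0 r1] xy.
have expL (s t : R) : 0 <= s -> 0 <= t -> `|expR (- s) - expR (- t)| <= `|s - t|.
  wlog st : s t / s <= t.
    move=> H s0 t0; have [st|/ltW ts] := leP s t; first exact: H.
    by rewrite distrC [leRHS]distrC H.
  move=> s0 t0; rewrite ger0_norm ?subr_ge0 ?ler_expR ?lerN2// distrC ger0_norm ?subr_ge0//.
  have -> : expR (- s) - expR (- t) = expR (- s) * (1 - expR (- (t - s))).
    by rewrite mulrBr mulr1 -expRD; congr (_ - expR _); ring.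
  rewrite -[leRHS]mul1r ler_pM ?expR_ge0//.
  - by rewrite subr_ge0 -expR0 ler_expR oppr_le0 subr_ge0.
  - by rewrite -expR0 ler_expR oppr_le0.
  - by have := expR_ge1Dx (- (t - s)); lra.
have hw v : 0 <= 2^-1 * wnorm S v ^+ 2 by apply: mulr_ge0; [|exact: sqr_ge0].
apply: le_trans (expL _ _ (hw _) (hw _)) _.
rewrite -mulrBr normrM ger0_norm//.
set c := _ * (16 * _ + _ + _).
set X := wnorm S (x - m) ^+ 2; set Y := wnorm S (y - m) ^+ 2.
have XY : (X - Y) ^+ 2 <= r ^+ 2 * c.
  have -> : X - Y = \sum_i (invmx (sqrtmx S) *m (x - y)) i 0 *
      (invmx (sqrtmx S) *m (x + y - 2 *: m)) i 0.
    rewrite /X /Y /wnorm !enorm2E -sumrB; apply: eq_bigr => i _.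
    have -> : x - y = (x - m) - (y - m) by apply/matrixP => ? ?; rewrite !mxE; ring.
    have -> : x + y - 2 *: m = (x - m) + (y - m) by apply/matrixP => ? ?; rewrite !mxE; ring.
    rewrite (mulmxBr _ (x - m)) (mulmxDr _ (x - m)).
    by move: (_ *m (x - m)) (_ *m (y - m)) => p q; rewrite !mxE; ring.
  apply: (le_trans (sumr_CauchySchwarz _ _)); rewrite -!enorm2E.
  have h1 := bS (x - y); have h2 := bS (x + y - 2 *: m).
  have h3 : enorm (x - y) ^+ 2 <= n%:R * r ^+ 2 by rewrite -enormN opprB.
  have h4 : enorm (x + y - 2 *: m) ^+ 2 <= 16 * enorm x ^+ 2 + 4 * n%:R + 8 * k ^+ 2.
    have -> : x + y - 2 *: m = (2 *: x + (y - x)) + (- 2) *: m.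
      by apply/matrixP => ? ?; rewrite !mxE; ring.
    have Z2 (t : R) (v : 'cV[R]_n) : enorm (t *: v) ^+ 2 = t ^+ 2 * enorm v ^+ 2.
      by rewrite !enorm2E mulr_sumr; apply: eq_bigr => i _; rewrite mxE exprMn.
    have := enorm2_add_le (2 *: x + (y - x)) (- 2 *: m).
    have := enorm2_add_le (2 *: x) (y - x); rewrite !Z2 sqrrN.
    have : enorm m ^+ 2 <= k ^+ 2 by rewrite lerXn2r ?nnegrE ?enorm_ge0// (le_trans (enorm_ge0 m)).
    have : n%:R * r ^+ 2 <= n%:R by rewrite ler_piMr// expr_le1.
    lra.
  rewrite /c (_ : r ^+ 2 * _ = (b * (n%:R * r ^+ 2)) *
    (b * (16 * enorm x ^+ 2 + 4 * n%:R + 8 * k ^+ 2))); last by ring.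
  apply: ler_pM; rewrite ?sqr_ge0//.
  - by rewrite (le_trans h1)// ler_wpM2l.
  - by rewrite (le_trans h2)// ler_wpM2l.
have c0 : 0 <= c.
  apply: mulr_ge0; first by rewrite mulr_ge0 ?sqr_ge0.
  have := sqr_ge0 (enorm x); have := sqr_ge0 k; have : 0 <= n%:R :> R by [].
  lra.
have : `|X - Y| <= r * (1 + c).
  rewrite -(@ler_pXn2r _ 2)// ?nnegrE ?mulr_ge0 ?addr_ge0// real_normK ?num_real//.
  rewrite (le_trans XY)// exprMn ler_wpM2l ?sqr_ge0//.
  rewrite sqrrD expr1n mul1r; have := sqr_ge0 c; lra.
have : 0 <= `|X - Y| by [].
lra.
Qed.

End gauss_pdf_theory.

(** * The density of the predicted measure *)

Section probability_average.
Context d (T : measurableType d) (R : realType) (mu : probability T R).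
Implicit Types f g : T -> R.

Lemma probability_integrable f (k : R) : measurable_fun setT f ->
  (forall x, `|f x| <= k) -> mu.-integrable setT (EFin \o f).
Proof.
move=> mf fk; apply: measurable_bounded_integrable => //.
  by apply: (@le_lt_trans _ _ 1%E); [exact: probability_le1|exact: ltry].
exists k; split; first exact: num_real.
by move=> r kr x _ /=; exact: le_trans (fk x) (ltW kr).
Qed.

Lemma probability_average_bounds f (lo hi : R) : measurable_fun setT f ->
  (forall x, lo <= f x <= hi) -> lo <= fine (\int[mu]_x (f x)%:E)%E <= hi.
Proof.
move=> mf fb.
have cstE (r : R) : \int[mu]_x r = r.
  rewrite Rintegral_cst// -[RHS]mulr1; congr (_ * _).
  by rewrite -[RHS]/(fine 1%E); congr fine; exact: probability_setT.
have ic (r : R) : mu.-integrable setT (EFin \o (fun=> r)).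
  by apply: (@probability_integrable (fun=> r) `|r|).
have fi : mu.-integrable setT (EFin \o f).
  apply: (@probability_integrable f (`|lo| + `|hi|)) => // x.
  have /andP[lof fhi] := fb x; have := ler_norm hi; have := ler_norm (- lo).
  rewrite normrN => ? ?; have := normr_ge0 lo; have := normr_ge0 hi => ? ?.
  by rewrite ler_norml; apply/andP; split; lra.
rewrite -[fine _]/(\int[mu]_x f x); apply/andP; split.
  rewrite -[leLHS]cstE; apply: le_Rintegral => // x _; by have /andP[] := fb x.
rewrite -[leRHS]cstE; apply: le_Rintegral => // x _; by have /andP[] := fb x.
Qed.

Lemma probability_average_dist f g (k e : R) :
  measurable_fun setT f -> measurable_fun setT g ->
  (forall x, `|f x| <= k) -> (forall x, `|g x| <= k) ->
  (forall x, `|f x - g x| <= e) ->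
  `|fine (\int[mu]_x (f x)%:E)%E - fine (\int[mu]_x (g x)%:E)%E| <= e.
Proof.
move=> mf mg fk gk fg.
rewrite -[fine _]/(\int[mu]_x f x) -[X in _ - X]/(\int[mu]_x g x).
rewrite -RintegralB//; last 2 first.
- exact: probability_integrable fk.
- exact: probability_integrable gk.
have mfg : measurable_fun setT (fun x => f x - g x) by exact: measurable_funB.
have : - e <= fine (\int[mu]_x (f x - g x)%:E)%E <= e.
  by apply: probability_average_bounds => // x; rewrite -ler_norml.
by rewrite -ler_norml.
Qed.

End probability_average.

Section prediction.
Context (R : realType) (d : nat).
Variables (Sigma : 'M[R]_d) (Psi : 'cV[R]_d -> 'cV[R]_d) (mu : probability 'cV[R]_d R).
Variables (kappa a b : R).
Hypotheses (Spd : posdefmx Sigma) (mPsi : measurable_fun setT Psi).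
Hypotheses (PsiK : forall v, enorm (Psi v) <= kappa).
Hypotheses (a0 : 0 < a) (b0 : 0 <= b).
Hypotheses (aS : forall v, a * enorm v ^+ 2 <= wnorm Sigma v ^+ 2).
Hypotheses (bS : forall v, wnorm Sigma v ^+ 2 <= b * enorm v ^+ 2).

Definition predicted_density (u : 'cV[R]_d) : R :=
  gauss_peak Sigma * fine (\int[mu]_v (gauss_kernel Sigma (Psi v) u)%:E)%E.

Lemma opPE : opP Psi Sigma mu = measure_of_density predicted_density.
Proof. by []. Qed.

Let mker u : measurable_fun setT (fun v => gauss_kernel Sigma (Psi v) u).
Proof.
apply: (measurableT_comp (f := fun m => gauss_kernel Sigma m u)) => //.
apply: measurable_fun_continuous_mx; apply: continuous_gaussian_kernel => i.
under eq_fun do rewrite !mxE.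
by apply: continuous_fun_sub; [exact: cst_continuous|exact: continuous_coord].
Qed.

Let ker1 u v : `|gauss_kernel Sigma (Psi v) u| <= 1.
Proof.
by rewrite ger0_norm ?expR_ge0// -expR0 ler_expR oppr_le0 mulr_ge0 ?sqr_ge0.
Qed.

Let ker_bounds u :
  expR (- (b * kappa ^+ 2)) * gauss b u <=
  fine (\int[mu]_v (gauss_kernel Sigma (Psi v) u)%:E)%E <=
  expR (a * kappa ^+ 2) * gauss (a / 4) u.
Proof.
apply: probability_average_bounds => // v.
by rewrite gauss_kernel_le// gauss_kernel_ge.
Qed.

Let peak0 := gauss_peak_gt0 Spd.

Lemma predicted_density_le u :
  predicted_density u <= gauss_peak Sigma * expR (a * kappa ^+ 2) * gauss (a / 4) u.
Proof. by rewrite -mulrA ler_wpM2l ?(ltW peak0)//; have /andP[] := ker_bounds u. Qed.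

Lemma predicted_density_ge u :
  gauss_peak Sigma * expR (- (b * kappa ^+ 2)) * gauss b u <= predicted_density u.
Proof. by rewrite -mulrA ler_wpM2l ?(ltW peak0)//; have /andP[] := ker_bounds u. Qed.

Lemma continuous_predicted_density : continuous predicted_density.
Proof.
move=> u; apply: (proj2 (@cvgrPdist_lt _ _ _ (nbhs u) _ _ _)) => e e0.
pose C := 1 + b ^+ 2 * d%:R * (16 * enorm u ^+ 2 + 4 * d%:R + 8 * kappa ^+ 2).
have C0 : 0 < C.
  rewrite ltr_pwDl// mulr_ge0 ?mulr_ge0 ?sqr_ge0//.
  by have := sqr_ge0 (enorm u); have := sqr_ge0 kappa; have : 0 <= d%:R :> R by []; lra.
pose r := Num.min 1 (e / (2 * (gauss_peak Sigma * C))).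
have pC0 : 0 < gauss_peak Sigma * C by rewrite mulr_gt0.
have r0 : 0 < r by rewrite lt_min ltr01 divr_gt0// mulr_gt0.
have r1 : r <= 1 by rewrite ge_min lexx.
have re : gauss_peak Sigma * C * r < e.
  have : r <= e / (2 * (gauss_peak Sigma * C)) by rewrite ge_min lexx orbT.
  rewrite ler_pdivlMr ?mulr_gt0//; lra.
apply/nbhs_ballP; exists r => //= v [_ uv].
have vu : enorm (v - u) ^+ 2 <= d%:R * r ^+ 2.
  rewrite enorm2E -[d in d%:R]card_ord -sum1_card natr_sum mulr_suml.
  apply: ler_sum => i _; rewrite mul1r -real_normK ?num_real//.
  rewrite lerXn2r ?nnegrE ?(ltW r0)// ltW//.
  by have := uv i 0; rewrite /ball /= !mxE distrC.
rewrite /predicted_density -mulrBr normrM (gtr0_norm peak0).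
apply: le_lt_trans re; rewrite -mulrA ler_wpM2l ?(ltW peak0)//.
apply: (@probability_average_dist _ _ _ mu _ _ 1) => // w.
by rewrite mulrC; apply: gauss_kernel_lipschitz => //; rewrite (ltW r0).
Qed.

End prediction.

(** * The joint density of state and observation *)

Section joint.
Context (R : realType) (d K : nat).
Local Notation leb n := (@lebesgue_cV R n).
Variables (q : 'cV[R]_d -> R) (h : 'cV[R]_d -> 'cV[R]_K) (Gamma : 'M[R]_K).
Variables (kappa a b A c a' b' : R).
Hypotheses (Gpd : posdefmx Gamma) (ch : continuous h).
Hypotheses (hK : forall u, enorm (h u) <= kappa).
Hypotheses (a0 : 0 < a) (b0 : 0 <= b).
Hypotheses (aG : forall v, a * enorm v ^+ 2 <= wnorm Gamma v ^+ 2).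
Hypotheses (bG : forall v, wnorm Gamma v ^+ 2 <= b * enorm v ^+ 2).
Hypotheses (cq : continuous q).
Hypothesis c0 : 0 < c.
Hypotheses (qA : forall u, q u <= A * gauss a' u).
Hypotheses (qc : forall u, c * gauss b' u <= q u).

Definition joint_density (x : 'cV[R]_(d + K)) : R :=
  q (usubmx x) * gauss_pdf (h (usubmx x)) Gamma (dsubmx x).

Let peak0 := gauss_peak_gt0 Gpd.

Lemma continuous_likelihood : continuous (fun x : 'cV[R]_(d + K) =>
  gauss_pdf (h (usubmx x)) Gamma (dsubmx x)).
Proof.
apply: continuous_fun_mul; first exact: cst_continuous.
apply: continuous_gaussian_kernel => i; under eq_fun do rewrite !mxE.
apply: continuous_fun_sub; first exact: continuous_coord.
apply: (continuous_fun_comp (g := fun u => h u i 0) (@continuous_usubmx R d K)).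
exact: (continuous_fun_comp (g := fun y : 'cV[R]_K => y i 0) ch (@continuous_coord R K i)).
Qed.

Lemma continuous_joint_density : continuous joint_density.
Proof.
apply: continuous_fun_mul.
  exact: (continuous_fun_comp (@continuous_usubmx R d K) cq).
exact: continuous_likelihood.
Qed.

Let q0 u : 0 < q u.
Proof. by rewrite (lt_le_trans _ (qc u))// mulr_gt0 ?gauss_gt0. Qed.

Lemma joint_density_gt0 x : 0 < joint_density x.
Proof. by rewrite mulr_gt0// gauss_pdf_gt0. Qed.

Lemma joint_density_le x : joint_density x <=
  A * (gauss_peak Gamma * expR (a * kappa ^+ 2)) * gauss (Num.min a' (a / 4)) x.
Proof.
have A0 : 0 <= A by have := le_trans (ltW (q0 0)) (qA 0); rewrite pmulr_lge0// gauss_gt0.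
rewrite -[x in leRHS]vsubmxK gauss_col_mx mulrACA ler_pM//.
- exact: ltW.
- exact/ltW/gauss_pdf_gt0.
- by rewrite (le_trans (qA _))// ler_wpM2l// gauss_decr// ge_min lexx.
- rewrite -mulrA ler_wpM2l ?(ltW peak0)//.
  rewrite (le_trans (gauss_kernel_le _ a0 aG (hK _)))// ler_wpM2l ?expR_ge0//.
  by rewrite gauss_decr// ge_min lexx orbT.
Qed.

Lemma joint_density_ge x :
  c * (gauss_peak Gamma * expR (- (b * kappa ^+ 2))) * gauss (Num.max b' b) x <=
  joint_density x.
Proof.
rewrite -[x in leLHS]vsubmxK gauss_col_mx mulrACA ler_pM//.
- by rewrite mulr_ge0 ?gauss_ge0 ?(ltW c0).
- by rewrite mulr_ge0 ?gauss_ge0// mulr_ge0 ?expR_ge0// (ltW peak0).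
- by rewrite (le_trans _ (qc _))// ler_wpM2l ?(ltW c0)// gauss_decr// le_max lexx.
- rewrite -mulrA ler_wpM2l ?(ltW peak0)//.
  rewrite (le_trans _ (gauss_kernel_ge _ b0 bG (hK _)))// ler_wpM2l ?expR_ge0//.
  by rewrite gauss_decr// le_max lexx orbT.
Qed.

Lemma joint_density_fibres (L : R) : b * K%:R <= L -> gauss_fibres L joint_density.
Proof.
move=> bL x z z1.
have [s sE] := gauss_pdf_line Gamma (h (usubmx x)) (dsubmx x) z.
exists s, (2^-1 * wnorm Gamma z ^+ 2); split.
  rewrite mulr_ge0 ?sqr_ge0//=.
  have := bG z; have := enorm2_le_unit z1; have := sqr_ge0 (wnorm Gamma z) => w0 zK wb.
  have : b * enorm z ^+ 2 <= b * K%:R by rewrite ler_wpM2l.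
  lra.
move=> t; rewrite /joint_density.
have -> : usubmx (x + t *: col_mx 0 z) = usubmx x.
  by rewrite linearD linearZ /= col_mxKu scaler0 addr0.
have -> : dsubmx (x + t *: col_mx 0 z) = dsubmx x + t *: z.
  by rewrite linearD linearZ /= col_mxKd.
by rewrite sE mulrA.
Qed.

(** Tonelli, after writing the inner integral as one over R^K of an indicator. *)
Lemma opQ_density (B : set 'cV[R]_(d + K)) : measurable B ->
  opQ h Gamma (measure_of_density q) B = measure_of_density joint_density B.
Proof.
move=> mB; rewrite /opQ.
have mpdf : measurable_fun setT (fun x : 'cV[R]_(d + K) =>
    gauss_pdf (h (usubmx x)) Gamma (dsubmx x)).
  exact: (measurable_fun_continuous_mx continuous_likelihood).
pose F (x : 'cV[R]_(d + K)) : \bar R :=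
  ((\1_B x)%:E * (gauss_pdf (h (usubmx x)) Gamma (dsubmx x))%:E)%E.
have F0 x : (0 <= F x)%E by rewrite /F -EFinM lee_fin mulr_ge0//; exact/ltW/gauss_pdf_gt0.
have mF : measurable_fun setT F.
  by apply: emeasurable_funM; apply/measurable_EFinP => //; exact: measurable_indic.
have innerE u : (\int[leb K]_(y in [set y | B (col_mx u y)]) (gauss_pdf (h u) Gamma y)%:E =
    \int[leb K]_y F (col_mx u y))%E.
  rewrite integral_mkcond; apply: eq_integral => y _.
  rewrite /F col_mxKu col_mxKd /patch indicE.
  have -> : (y \in [set y | B (col_mx u y)]) = (col_mx u y \in B).
    by apply/idP/idP; rewrite !inE.
  by case: ifP => _; rewrite ?mul1e ?mul0e.
under eq_fun do rewrite innerE.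
have mq : measurable_fun setT q by exact: measurable_fun_continuous_mx.
have mI : measurable_fun setT (fun u => \int[leb K]_y F (col_mx u y))%E.
  exact: measurable_integral_col_mx.
rewrite (@ge0_integral_density _ _ _ (leb d) q)//; last 2 first.
- by move=> u; exact: ltW.
- by move=> u; apply: integral_ge0.
rewrite /measure_of_density [RHS]integral_mkcond.
rewrite [RHS](eq_integral (fun x => F x * (q (usubmx x))%:E)%E); last first.
  move=> x _; rewrite /patch /F indicE; case: ifPn => xB.
    by rewrite mul1e -EFinM mulrC.
  by rewrite mul0e mul0e.
have mqu : measurable_fun setT (fun x : 'cV[R]_(d + K) => (q (usubmx x))%:E).
  apply/measurable_EFinP; apply: measurable_fun_continuous_mx.
  exact: (continuous_fun_comp (@continuous_usubmx R d K) cq).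
clearbody F.
rewrite [RHS]integral_col_mx//; last 2 first.
- exact: emeasurable_funM.
- by move=> x; rewrite mule_ge0// lee_fin ltW.
apply: eq_integral => u _; rewrite -ge0_integralZr//.
- by apply: eq_integral => y _; rewrite col_mxKu.
- by apply: (measurableT_comp mF); exact: measurable_col_mxl.
- by rewrite lee_fin ltW.
Qed.

End joint.

(** * Conditioning densities that satisfy Gaussian bounds *)

Section analysis_step.
Context (R : realType) (d K : nat).
Implicit Types (p g : 'cV[R]_(d + K) -> R) (nu rho : set 'cV[R]_(d + K) -> \bar R).

Lemma opB_density ydag j nu p : is_continuous_density nu p ->
  opB ydag j nu = measure_of_density
    (fun u => p (col_mx u (ydag j.+1)) / slice_mass p (ydag j.+1)).
Proof. by move=> pd; rewrite /opB (continuous_density_unique pd). Qed.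

Lemma gauss_dominated_divr n (q : 'cV[R]_n -> R) (z : R) : 0 <= z ->
  gauss_dominated q -> gauss_dominated (fun x => q x / z).
Proof.
move=> z0 [[A a] /= a0 qA]; exists (A / z, a) => // x /=.
by rewrite mulrAC ler_wpM2r// invr_ge0.
Qed.

(** By [dg_densityE] both sides are weighted L^1 norms, of the normalized slices on
    the left and of the joint densities on the right. *)
Lemma dg_opB_le ydag j nu rho p g (A a c b L k : R) :
  is_continuous_density nu p -> is_continuous_density rho g ->
  0 < a -> (forall x, p x <= A * gauss a x) -> gauss_dominated g ->
  0 < c -> 0 <= b ->
  (forall x, c * gauss b x <= p x) -> (forall x, c * gauss b x <= g x) ->
  gauss_fibres L p -> gauss_fibres L g -> enorm (ydag j.+1) <= k ->
  (dg (opB ydag j rho) (opB ydag j nu) <=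
   (conditioning_cst d A a c b L k)%:E * dg rho nu)%E.
Proof.
move=> pd gd a0 pA gD c0 b0 pc gc pL gL yk; set y := ydag j.+1 in yk *.
have [cp p0 nuE] := pd; have [cg g0 rhoE] := gd.
have mp := measurable_fun_continuous_mx cp.
have mg := measurable_fun_continuous_mx cg.
have dp : gauss_dominated p by exists (A, a).
rewrite (dg_densityE mg mp g0 p0 gD dp rhoE nuE).
have ms (q : 'cV[R]_(d + K) -> R) : measurable_fun setT q ->
    measurable_fun [set: 'cV[R]_d] (fun u => q (col_mx u y) / slice_mass q y : R).
  move=> mq; apply: measurable_funM => //.
  by apply: measurableT_comp => //; exact: measurable_col_mxr.
have z0 (q : 'cV[R]_(d + K) -> R) : (forall x, 0 <= q x) -> 0 <= slice_mass q y.
  by move=> q0; apply: fine_ge0; apply: integral_ge0 => u _; rewrite lee_fin.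
rewrite (opB_density _ _ pd) (opB_density _ _ gd) -/y.
rewrite (dg_densityE (ms _ mg) (ms _ mp)) //.
- exact: conditioning_weighted_L1_le.
- by move=> u; rewrite divr_ge0// z0.
- by move=> u; rewrite divr_ge0// z0.
- by apply: gauss_dominated_divr; [exact: z0|exact: slice_dominated].
- by apply: gauss_dominated_divr; [exact: z0|exact: slice_dominated].
Qed.

End analysis_step.

(** * The Gaussian projection *)

Section gaussian_projection.
Context (R : realType) (n : nat).
Variables (p : 'cV[R]_n -> R) (nu : set 'cV[R]_n -> \bar R) (A a c b : R).
Hypotheses (n0 : (0 < n)%N) (pd : is_continuous_density nu p).
Hypotheses (a0 : 0 < a) (pA : forall x, p x <= A * gauss a x).
Hypotheses (c0 : 0 < c) (b0 : 0 <= b) (pc : forall x, c * gauss b x <= p x).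

Definition moment_bound : R := A * gauss_moment n a.

(** The coercivity constant provided by [cov_coercive] for the covariance. *)
Definition cov_lower : R := c * expR (- (b * (4 * n%:R))) / (4 * n%:R).

(** The Leibniz formula bounds the determinant of the covariance through its
    entries; the summand 1 keeps the bound positive. *)
Definition det_upper : R := 1 + (n`!)%:R * (2 * (1 + moment_bound ^+ 2) * moment_bound) ^+ n.
Definition projection_lower : R :=
  (Num.sqrt ((2 * pi) ^+ n * det_upper))^-1 *
  expR (- (cov_lower^-1 * (n%:R * moment_bound ^+ 2))).

Let mp := let: And3 cp _ _ := pd in measurable_fun_continuous_mx cp.
Let p0 := let: And3 _ p0 _ := pd in p0.
Let nuE := let: And3 _ _ nuE := pd in nuE.

Let A0 : 0 <= A.
Proof. by have := le_trans (p0 0) (pA 0); rewrite pmulr_lge0// gauss_gt0. Qed.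

Let M0 : 0 <= moment_bound.
Proof. by rewrite mulr_ge0 ?gauss_moment_ge0. Qed.

Lemma cov_lower_gt0 : 0 < cov_lower.
Proof. by rewrite divr_gt0 ?mulr_gt0 ?expR_gt0 ?ltr0n. Qed.

Let coercive := cov_coercive mp p0 nuE a0 pA n0 c0 b0 pc.

Lemma cov_posdef : posdefmx (cov nu).
Proof. exact: posdefmx_of_coercive cov_lower_gt0 (cov_sym nu) coercive. Qed.

Lemma opG_density : is_continuous_density (opG nu) (gauss_pdf (mean nu) (cov nu)).
Proof.
split; first exact: continuous_gauss_pdf.
  by move=> x; exact/ltW/gauss_pdf_gt0/cov_posdef.
by move=> B _; rewrite /opG /gaussian posdefmx_unit//; exact: cov_posdef.
Qed.

(** These constants depend on [nu]. That is harmless, because domination is only used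
    for the finiteness of integrals. *)
Lemma opG_dominated : gauss_dominated (gauss_pdf (mean nu) (cov nu)).
Proof.
have [a' a'0 a'C] := wnorm_coercive cov_posdef.
exists (gauss_peak (cov nu) * expR (a' * enorm (mean nu) ^+ 2), a' / 4) => [|x] /=.
  by rewrite divr_gt0.
rewrite -mulrA ler_wpM2l ?(ltW (gauss_peak_gt0 cov_posdef))//.
exact: gauss_kernel_le.
Qed.

Let cov_wnorm v : wnorm (cov nu) v ^+ 2 <= cov_lower^-1 * enorm v ^+ 2.
Proof. exact: wnorm_le_coercive cov_lower_gt0 (cov_sym nu) coercive. Qed.

Lemma projection_lower_gt0 : 0 < projection_lower.
Proof.
rewrite mulr_gt0 ?expR_gt0// invr_gt0 sqrtr_gt0 mulr_gt0 ?exprn_gt0//.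
  by rewrite mulr_gt0// pi_gt0.
by rewrite ltr_pwDl// mulr_ge0// exprn_ge0// mulr_ge0// mulr_ge0// addr_ge0// sqr_ge0.
Qed.

(** The determinant in the normalizing factor is bounded above, the exponent is
    bounded by coercivity of the covariance, and the mean is bounded. *)
Lemma opG_density_ge x :
  projection_lower * gauss cov_lower^-1 x <= gauss_pdf (mean nu) (cov nu) x.
Proof.
have l0 : 0 <= cov_lower^-1 by rewrite invr_ge0 ltW// cov_lower_gt0.
have mK : enorm (mean nu) <= Num.sqrt (n%:R * moment_bound ^+ 2).
  rewrite ler_wsqrtr// -[n in n%:R]card_ord -sum1_card natr_sum mulr_suml.
  apply: ler_sum => i _; rewrite mul1r -real_normK ?num_real//.
  by rewrite lerXn2r ?nnegrE// (mean_le mp p0 nuE a0 pA).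
have k2 : 0 <= n%:R * moment_bound ^+ 2 by rewrite mulr_ge0 ?sqr_ge0.
rewrite /projection_lower -mulrA ler_pM ?invr_ge0 ?sqrtr_ge0//.
- by rewrite mulr_ge0 ?expR_ge0 ?gauss_ge0.
- have det0 := posdefmx_det_gt0 cov_posdef.
  have detD : \det (cov nu) <= det_upper.
    rewrite (le_trans (ler_norm _))// (le_trans (det_norm_le (cov_le mp p0 nuE a0 pA)))//.
    by rewrite /det_upper lerDr.
  have pin : 0 < (2 * pi) ^+ n :> R by rewrite exprn_gt0// mulr_gt0// pi_gt0.
  have D0 : 0 < det_upper by exact: lt_le_trans detD.
  rewrite lef_pV2 ?posrE ?sqrtr_gt0 ?mulr_gt0// ler_wsqrtr//.
  by rewrite ler_pM2l.
- have := gauss_kernel_ge x l0 cov_wnorm mK; rewrite sqr_sqrtr//.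
Qed.

End gaussian_projection.

Lemma opG_density_fibres (R : realType) d K (p : 'cV[R]_(d + K) -> R) nu (A a c b L : R)
    (n0 : (0 < d + K)%N) (pd : is_continuous_density nu p)
    (a0 : 0 < a) (pA : forall x, p x <= A * gauss a x)
    (c0 : 0 < c) (b0 : 0 <= b) (pc : forall x, c * gauss b x <= p x) :
  (cov_lower (d + K) c b)^-1 * K%:R <= L ->
  gauss_fibres L (gauss_pdf (mean nu) (cov nu)).
Proof.
have [cp p0 nuE] := pd; have mp := measurable_fun_continuous_mx cp.
have l0 := cov_lower_gt0 b n0 c0.
move=> lL x z z1; have [s sE] := gauss_pdf_line (cov nu) (mean nu) x (col_mx 0 z).
exists s, (2^-1 * wnorm (cov nu) (col_mx 0 z) ^+ 2); split => //.
rewrite mulr_ge0 ?sqr_ge0//=.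
have := wnorm_le_coercive (col_mx 0 z) l0 (cov_sym nu)
  (cov_coercive mp p0 nuE a0 pA n0 c0 b0 pc).
rewrite enorm2_col_mx enorm2E big1 ?add0r => [wl|i _]; last by rewrite mxE expr0n.
have zK := enorm2_le_unit z1; have w0 := sqr_ge0 (wnorm (cov nu) (col_mx 0 z)).
have : (cov_lower (d + K) c b)^-1 * enorm z ^+ 2 <= (cov_lower (d + K) c b)^-1 * K%:R.
  by rewrite ler_wpM2l// invr_ge0 ltW.
lra.
Qed.

Unset Implicit Arguments.

(** * The theorem *)

Theorem lemma25 (R : realType) (d K : nat) (hd : (1 <= d)%N) (hK : (1 <= K)%N)
    (kappa_y kappa_Psi kappa_h : R)
    (hky : 0 < kappa_y) (hkPsi : 0 < kappa_Psi) (hkh : 0 < kappa_h)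
    (Sigma : 'M[R]_d) (Gamma : 'M[R]_K)
    (hSigma : posdefmx Sigma) (hGamma : posdefmx Gamma) :
  exists CB : R,
    forall (J : nat) (hJ : (1 <= J)%N) (ydag : nat -> 'cV[R]_K)
      (hy : forall j, (1 <= j <= J)%N -> enorm (ydag j) <= kappa_y)
      (Psi : 'cV[R]_d -> 'cV[R]_d)
      (mPsi : measurable_fun [set: 'cV[R]_d] Psi)
      (hPsi : forall v, enorm (Psi v) <= kappa_Psi)
      (h : 'cV[R]_d -> 'cV[R]_K)
      (ch : continuous h)
      (hh : forall u, enorm (h u) <= kappa_h)
      (mu : probability 'cV[R]_d R) (j : nat) (hj : (j < J)%N),
    (dg (opB ydag j (opG (opQ h Gamma (opP Psi Sigma mu))))
        (opB ydag j (opQ h Gamma (opP Psi Sigma mu)))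
     <= CB%:E * dg (opG (opQ h Gamma (opP Psi Sigma mu)))
                   (opQ h Gamma (opP Psi Sigma mu)))%E.
Proof.
have [aS aS0 aSP] := wnorm_coercive hSigma.
have [bS bS0 bSP] := wnorm_bounded Sigma.
have [aG aG0 aGP] := wnorm_coercive hGamma.
have [bG bG0 bGP] := wnorm_bounded Gamma.
have pS0 := gauss_peak_gt0 hSigma; have pG0 := gauss_peak_gt0 hGamma.
have n0 : (0 < d + K)%N by rewrite addn_gt0 hd.
pose A := gauss_peak Sigma * expR (aS * kappa_Psi ^+ 2) *
  (gauss_peak Gamma * expR (aG * kappa_h ^+ 2)).
pose a := Num.min (aS / 4) (aG / 4).
pose c := gauss_peak Sigma * expR (- (bS * kappa_Psi ^+ 2)) *
  (gauss_peak Gamma * expR (- (bG * kappa_h ^+ 2))).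
pose b := Num.max bS bG.
have a0 : 0 < a by rewrite lt_min !divr_gt0.
have c0 : 0 < c by rewrite !mulr_gt0 ?expR_gt0.
have b0 : 0 < b by rewrite lt_max bS0.
pose c' := projection_lower (d + K) A a c b.
pose l := (cov_lower (d + K) c b)^-1.
(* p lies between c exp (- b |x|^2) and A exp (- a |x|^2), while c' exp (- l |x|^2)
   bounds the density of the Gaussian projection from below. *)
exists (conditioning_cst d A a (Num.min c c') (Num.max b l)
  (bG * K%:R + l * K%:R) kappa_y).
move=> J hJ ydag hy Psi mPsi hPsi h ch hh mu j hj.
pose q := predicted_density Sigma Psi mu.
have qA u : q u <= gauss_peak Sigma * expR (aS * kappa_Psi ^+ 2) * gauss (aS / 4) u.
  exact: (predicted_density_le _ hSigma mPsi hPsi aS0 (ltW bS0) aSP bSP).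
have qc u : gauss_peak Sigma * expR (- (bS * kappa_Psi ^+ 2)) * gauss bS u <= q u.
  exact: (predicted_density_ge _ hSigma mPsi hPsi aS0 (ltW bS0) aSP bSP).
have cq : continuous q.
  exact: (continuous_predicted_density hSigma mPsi hPsi (ltW bS0) bSP).
have cS0 : 0 < gauss_peak Sigma * expR (- (bS * kappa_Psi ^+ 2)).
  by rewrite mulr_gt0 ?expR_gt0.
set nu := opQ h Gamma (opP Psi Sigma mu).
pose p := joint_density q h Gamma.
have p0 x : 0 < p x by exact: (joint_density_gt0 _ hGamma cS0 qc).
have pA x : p x <= A * gauss a x.
  exact: (joint_density_le hGamma hh aG0 aGP cS0 qA qc x).
have pc x : c * gauss b x <= p x.
  exact: (joint_density_ge hGamma hh (ltW bG0) bGP cS0 qc x).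
have pd : is_continuous_density nu p.
  split; first exact: (continuous_joint_density ch cq).
    by move=> x; exact: ltW.
  by move=> B mB; rewrite /nu opPE; exact: (opQ_density hGamma ch cq cS0 qc mB).
have gd := opG_density n0 pd a0 pA c0 (ltW b0) pc.
have l0 : 0 < l by rewrite invr_gt0 cov_lower_gt0.
have c'0 : 0 < c' by exact: (projection_lower_gt0 c b pd pA).
have K0 : 0 <= K%:R :> R by [].
apply: (dg_opB_le pd gd a0 pA).
- exact: (opG_dominated n0 pd a0 pA c0 (ltW b0) pc).
- by rewrite lt_min c0.
- by rewrite le_max ltW.
- move=> x; rewrite (le_trans _ (pc x))// ler_pM ?gauss_ge0 ?le_min ?(ltW c0) ?(ltW c'0)//.
    by rewrite ge_min lexx.
  by rewrite gauss_decr// le_max lexx.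
- move=> x; rewrite (le_trans _ (opG_density_ge n0 pd a0 pA c0 (ltW b0) pc x))//.
  rewrite ler_pM ?gauss_ge0 ?le_min ?(ltW c0) ?(ltW c'0)//.
    by rewrite ge_min lexx orbT.
  by rewrite gauss_decr// le_max lexx orbT.
- apply: (joint_density_fibres _ _ (ltW bG0) bGP).
  by rewrite lerDl mulr_ge0 ?(ltW l0).
- apply: (opG_density_fibres n0 pd a0 pA c0 (ltW b0) pc).
  by rewrite lerDr mulr_ge0// ltW.
- exact: hy.
Qed.
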